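(* Let $A=\bigoplus_{n\ge 0}A_n$ be a finitely generated graded domain over an algebraically closed field $k=A_0$ ($A$ need not be standard graded). Assume $\dim A=2$, and further assume: (1) there exists a Noether normalization $T=k[X_1,X_2]$ of $A$ with $\deg X_1=\deg X_2=m$; (2) for every $\xi\in T_m$ with $\xi\ne 0$ we have $\sharp\operatorname{Ass}^{(1)}_A(A/\xi A)=1$. If $R$ is a graded ring such that we have inclusions of graded rings $T\subseteq R\subseteq A$, then $A_1(R)$, the first Chow group of $R$, is a torsion group.
   Context: A Noether normalization $T=k[X_1,X_2]$ of $A$ is here a graded polynomial subring, generated by homogeneous algebraically independent elements, over which $A$ is a finite module. $T_m$ is the degree $m$ component of $T$. $\operatorname{Ass}^{(i)}_A(M)$ denotes the set of associated primes of the $A$-module $M$ of height $i$, and $\sharp$ denotes cardinality. For an affine algebra $R$ over a field (here $R$ is a finite $T$-module, hence affine), Chow groups are defined as follows, where $\dim$ is Krull dimension. $Z_i(R)$ is the free abelian group with basis the symbols $[R/P]$, $P$ a prime ideal of $R$ with $\dim R/P=i$. For a finitely generated $R$-module $M$ with $\dim M\le i$, put $[M]_i=\sum_{\dim R/P=i}\operatorname{length}(M_P)\,[R/P]\in Z_i(R)$. For a prime $Q$ with $\dim R/Q=i+1$ and an element $x\in R\setminus Q$, put $\operatorname{div}(Q,x)=[(R/Q)/x(R/Q)]_i$. The Chow group $A_i(R)$ is the quotient of $Z_i(R)$ by the subgroup generated by all $\operatorname{div}(Q,x)$ with $Q$ prime, $\dim R/Q=i+1$, and $x\notin Q$ (rational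 equivalence). *)

(* Defs.v *)
From HB Require Import structures.
From mathcomp Require Import all_boot all_order all_algebra generic_quotient.
From mathcomp Require Import boolp classical_sets functions cardinality fsbigop.
From mathcomp Require Import freeg ring.
From mathcomp Require mpoly.

Set Implicit Arguments.
Unset Strict Implicit.
Unset Printing Implicit Defensive.

Import GRing.Theory.

Local Open Scope ring_scope.
Local Open Scope quotient_scope.

(* A bundled variant of [prime_idealr]: the universe of the type [prime_idealr R]
   does not allow one to form [set (prime_idealr R)]. For the same reason the
   first field has type [R -> bool] and not [{pred R}]. *)
Record prime_ideal (R : nzRingType) := PrimeIdeal {
  prime_pred : R -> bool;
  prime_pred_ideal : idealr_closed prime_pred;
  prime_pred_prime : prime_idealr_closed prime_pred
}.

Definition prime_mem (R : nzRingType) (P : prime_ideal R) : {pred R} :=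
  prime_pred P.

Coercion prime_mem : prime_ideal >-> pred_sort.

HB.instance Definition _ (R : nzRingType) (P : prime_ideal R) :=
  isIdealr.Build R (prime_mem P) (prime_pred_ideal P).
HB.instance Definition _ (R : nzRingType) (P : prime_ideal R) :=
  isPrimeIdealrClosed.Build R (prime_mem P) (@prime_pred_prime R P).

HB.instance Definition _ (R : nzRingType) := gen_eqMixin (prime_ideal R).
HB.instance Definition _ (R : nzRingType) := gen_choiceMixin (prime_ideal R).

(* By functional extensionality and proof irrelevance, a prime ideal is
   determined by its elements. *)
Lemma prime_ideal_inj (R : nzRingType) (P Q : prime_ideal R) : P =i Q -> P = Q.
Proof.
case: P Q => [P iP pP] [Q iQ pQ] PQ.
have E : P = Q by apply/funext => x; exact: (PQ x).
by case: Q / E iQ pQ {PQ} => iQ pQ; congr PrimeIdeal; apply: Prop_irrelevance.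
Qed.

Definition strict_sub (T : Type) (A B : {pred T}) : Prop :=
  {subset A <= B} /\ ~ {subset B <= A}.

Definition strict_chain (T : Type) (n : nat) (C : 'I_n.+1 -> {pred T}) : Prop :=
  forall i j : 'I_n.+1, (i < j)%N -> strict_sub (C i) (C j).

Definition is_maximum (B : nat -> Prop) (d : nat) : Prop :=
  B d /\ forall n, B n -> (n <= d)%N.

Definition has_krull_dim (S : comNzRingType) (d : nat) : Prop :=
  is_maximum (fun n => exists C : 'I_n.+1 -> prime_ideal S,
    strict_chain (fun i => C i : {pred S})) d.

Definition has_height (S : comNzRingType) (P : prime_ideal S) (h : nat) : Prop :=
  is_maximum (fun n => exists C : 'I_n.+1 -> prime_ideal S,
    strict_chain (fun i => C i : {pred S}) /\ C ord_max =i P) h.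

Definition has_length (S : comNzRingType) (M : lmodType S) (l : nat) : Prop :=
  is_maximum (fun n => exists C : 'I_n.+1 -> submodClosed M,
    strict_chain (fun i => C i : {pred M})) l.

(* Junk value 0 when [M] has infinite length. *)
Definition length (S : comNzRingType) (M : lmodType S) : nat :=
  xget 0%N [set l | has_length M l]%classic.

Section QuotientModule.
Variables (R : comNzRingType) (M : lmodType R) (N : submodClosed M).

Definition submod_pred : {pred M} := fun v => v \in N.

Fact submod_pred_closed : zmod_closed submod_pred.
Proof. exact: GRing.submod_closedB (GRing.submodClosedP N). Qed.

HB.instance Definition _ := GRing.isZmodClosed.Build M submod_pred
  submod_pred_closed.

Definition quot_mod : Type := Quotient.quot submod_pred.

HB.instance Definition _ := GRing.Zmodule.on quot_mod.

Definition quot_scale (a : R) (x : quot_mod) : quot_mod :=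
  \pi_({ideal_quot submod_pred}) (a *: repr (x : {ideal_quot submod_pred})).

Lemma pi_quot_scale a (v : M) :
  quot_scale a (\pi_({ideal_quot submod_pred}) v) =
    \pi_({ideal_quot submod_pred}) (a *: v).
Proof.
set r := repr (\pi_({ideal_quot submod_pred}) v).
have rvN : r - v \in N.
  by change (r - v \in submod_pred); rewrite Quotient.idealrBE reprK.
apply/eqP; rewrite /quot_scale -Quotient.idealrBE -scalerBr.
exact: (@rpredZ _ _ N a _ rvN).
Qed.

Fact quot_scaleA a b x : quot_scale a (quot_scale b x) = quot_scale (a * b) x.
Proof. by elim/quotW: x => v; rewrite (pi_quot_scale b v) !pi_quot_scale scalerA. Qed.

Fact quot_scale1 : left_id 1 quot_scale.
Proof. by elim/quotW => v; rewrite pi_quot_scale scale1r. Qed.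

Fact quot_scaleDr : right_distributive quot_scale +%R.
Proof.
move=> a; elim/quotW=> v; elim/quotW=> w.
by rewrite -[X in quot_scale a X]raddfD !pi_quot_scale scalerDr raddfD.
Qed.

Fact quot_scaleDl x : {morph quot_scale^~ x : a b / a + b}.
Proof.
by elim/quotW: x => v a b; rewrite !pi_quot_scale scalerDl raddfD.
Qed.

HB.instance Definition _ := GRing.Zmodule_isLmodule.Build R quot_mod
  quot_scaleA quot_scale1 quot_scaleDr quot_scaleDl.

End QuotientModule.

Section Multiples.
Variables (R : comNzRingType) (M : lmodType R) (x : R).

Definition multiples : {pred M} := fun v => `[< exists w : M, v = x *: w >].

Fact multiples_closed : subsemimod_closed multiples.
Proof.
split; first split.
- by apply/asboolP; exists 0; rewrite scaler0.
- move=> u v /asboolP[u' ->] /asboolP[v' ->].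
  by apply/asboolP; exists (u' + v'); rewrite scalerDr.
- move=> a v /asboolP[w ->].
  by apply/asboolP; exists (a *: w); rewrite !scalerA mulrC.
Qed.

HB.instance Definition _ := GRing.isSubmodClosed.Build R M multiples
  multiples_closed.

End Multiples.
Arguments multiples {R} M x.

Section IdealSubmodule.
Variables (R : comNzRingType) (I : idealr R).

Definition ideal_submod : {pred R^o} := fun a => (a : R) \in I.

Fact ideal_submod_closed : subsemimod_closed ideal_submod.
Proof.
split; first split.
- exact: (rpred0 I).
- by move=> u v; apply: (rpredD (S := I)).
- by move=> a v; apply: idealMr.
Qed.

HB.instance Definition _ := GRing.isSubmodClosed.Build R R^o ideal_submod
  ideal_submod_closed.

End IdealSubmodule.

Section Localization.
Variables (R : comNzRingType) (P : prime_ideal R).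

Definition denom : Type := {s : R | s \notin P}.

HB.instance Definition _ := Choice.on denom.

Fact denom1_subproof : 1 \notin P. Proof. by rewrite idealr1. Qed.
Definition denom1 : denom := Sub 1 denom1_subproof.

Fact denomM_subproof (s t : denom) : val s * val t \notin P.
Proof. by rewrite prime_idealrM negb_or (valP s) (valP t). Qed.
Definition denomM (s t : denom) : denom := Sub (val s * val t) (denomM_subproof s t).

(* Unlike [/=], these leave [val] folded, as [ring] requires. *)
Lemma val_denom1 : val denom1 = 1. Proof. by []. Qed.
Lemma val_denomM s t : val (denomM s t) = val s * val t. Proof. by []. Qed.
Let valE := (val_denom1, val_denomM).

Section Module.
Variable M : lmodType R.

(* (v, s) ~ (w, t) iff u (t v - s w) = 0 for some u not in P *)
Definition loc_equiv (x y : M * denom) : bool :=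
  `[< exists u : denom,
        val u *: (val y.2 *: x.1) = val u *: (val x.2 *: y.1) >].

Fact loc_equiv_refl : reflexive loc_equiv.
Proof. by move=> x; apply/asboolP; exists denom1. Qed.

Fact loc_equiv_sym : symmetric loc_equiv.
Proof. by move=> x y; apply/asboolP/asboolP => -[u uxy]; exists u. Qed.

Fact loc_equiv_trans : transitive loc_equiv.
Proof.
move=> y x z /asboolP[u uxy] /asboolP[v vyz]; apply/asboolP.
exists (denomM (denomM u v) y.2); rewrite !valE.
transitivity ((val v * val z.2) *: (val u *: (val y.2 *: x.1))).
  by rewrite !scalerA; congr (_ *: _); ring.
rewrite uxy.
transitivity ((val u * val x.2) *: (val v *: (val z.2 *: y.1))).
  by rewrite !scalerA; congr (_ *: _); ring.
by rewrite vyz !scalerA; congr (_ *: _); ring.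
Qed.

Canonical loc_equiv_rel :=
  EquivRel loc_equiv loc_equiv_refl loc_equiv_sym loc_equiv_trans.
Canonical loc_equiv_encModRel := defaultEncModRel loc_equiv.

Definition loc_mod : Type := {eq_quot loc_equiv}.

HB.instance Definition _ := Choice.on loc_mod.

Definition loc_frac (v : M) (s : denom) : loc_mod :=
  \pi_({eq_quot loc_equiv}) (v, s).

Definition loc_num (x : loc_mod) : M := (repr (x : {eq_quot loc_equiv})).1.
Definition loc_den (x : loc_mod) : denom := (repr (x : {eq_quot loc_equiv})).2.

Lemma loc_fracP (v w : M) (s t : denom) : loc_frac v s = loc_frac w t <->
  exists u : denom, val u *: (val t *: v) = val u *: (val s *: w).
Proof.
split=> [/eqmodP/asboolP//|uvw].
by apply/eqmodP/asboolP.
Qed.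

Lemma loc_frac_numden (x : loc_mod) : loc_frac (loc_num x) (loc_den x) = x.
Proof. by rewrite /loc_frac /loc_num /loc_den -surjective_pairing reprK. Qed.

Lemma loc_numdenP (v : M) (s : denom) : exists u : denom,
  val u *: (val s *: loc_num (loc_frac v s)) =
  val u *: (val (loc_den (loc_frac v s)) *: v).
Proof. by apply/loc_fracP; rewrite loc_frac_numden. Qed.

Lemma loc_frac_ind (K : loc_mod -> Prop) :
  (forall v s, K (loc_frac v s)) -> forall x, K x.
Proof. by move=> Kfrac x; rewrite -[x]loc_frac_numden. Qed.

Lemma eq_loc_frac (v w : M) (s t : denom) :
  val t *: v = val s *: w -> loc_frac v s = loc_frac w t.
Proof. by move=> e; apply/loc_fracP; exists denom1; rewrite e. Qed.

Definition loc_zero : loc_mod := loc_frac 0 denom1.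

Definition loc_opp (x : loc_mod) : loc_mod := loc_frac (- loc_num x) (loc_den x).

Definition loc_add (x y : loc_mod) : loc_mod :=
  loc_frac (val (loc_den y) *: loc_num x + val (loc_den x) *: loc_num y)
    (denomM (loc_den x) (loc_den y)).

Lemma loc_oppE v s : loc_opp (loc_frac v s) = loc_frac (- v) s.
Proof.
have [u e] := loc_numdenP v s; rewrite /loc_opp.
by apply/loc_fracP; exists u; rewrite !scalerN e.
Qed.

Lemma loc_addE v s w t : loc_add (loc_frac v s) (loc_frac w t) =
  loc_frac (val t *: v + val s *: w) (denomM s t).
Proof.
have [u e] := loc_numdenP v s; have [u' e'] := loc_numdenP w t.
rewrite /loc_add; move: e e'.
move: (loc_num (loc_frac v s)) (loc_den (loc_frac v s)) => v' s'.
move: (loc_num (loc_frac w t)) (loc_den (loc_frac w t)) => w' t' e e'.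
apply/loc_fracP; exists (denomM u u'); rewrite !valE !scalerDr; congr (_ + _).
  transitivity ((val u' * val t * val t') *: (val u *: (val s *: v'))).
    by rewrite !scalerA; congr (_ *: _); ring.
  by rewrite e !scalerA; congr (_ *: _); ring.
transitivity ((val u * val s * val s') *: (val u' *: (val t *: w'))).
  by rewrite !scalerA; congr (_ *: _); ring.
by rewrite e' !scalerA; congr (_ *: _); ring.
Qed.

Fact loc_addA : associative loc_add.
Proof.
elim/loc_frac_ind=> v s; elim/loc_frac_ind=> w t; elim/loc_frac_ind=> z r.
rewrite !loc_addE; apply: eq_loc_frac; rewrite !valE !scalerDr !scalerA -addrA.
by congr (_ *: _ + (_ *: _ + _ *: _)); ring.
Qed.

Fact loc_addC : commutative loc_add.
Proof.
elim/loc_frac_ind=> v s; elim/loc_frac_ind=> w t.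
rewrite !loc_addE; apply: eq_loc_frac; rewrite !valE !scalerDr !scalerA addrC.
by congr (_ *: _ + _ *: _); ring.
Qed.

Fact loc_add0 : left_id loc_zero loc_add.
Proof.
elim/loc_frac_ind=> v s; rewrite loc_addE; apply: eq_loc_frac.
by rewrite !valE scaler0 add0r scale1r mul1r.
Qed.

Fact loc_addN : left_inverse loc_zero loc_opp loc_add.
Proof.
elim/loc_frac_ind=> v s; rewrite loc_oppE loc_addE; apply: eq_loc_frac.
by rewrite scalerN addNr !scaler0.
Qed.

HB.instance Definition _ := GRing.isZmodule.Build loc_mod
  loc_addA loc_addC loc_add0 loc_addN.

Lemma loc_fracD v s w t : loc_frac v s + loc_frac w t =
  loc_frac (val t *: v + val s *: w) (denomM s t).
Proof. exact: loc_addE. Qed.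

End Module.

(* The localization of [R] at [P], on the same carrier as that of [R^o]. *)
Definition loc_ring : Type := loc_mod R^o.

HB.instance Definition _ := GRing.Zmodule.on loc_ring.

Section Scale.
Variable M : lmodType R.

Definition loc_scale (a : loc_ring) (x : loc_mod M) : loc_mod M :=
  loc_frac ((loc_num a : R) *: loc_num x) (denomM (loc_den a) (loc_den x)).

Lemma loc_scaleE (a : R^o) s (v : M) t :
  loc_scale (loc_frac a s) (loc_frac v t) = loc_frac ((a : R) *: v) (denomM s t).
Proof.
have [u e] := loc_numdenP a s; have [u' e'] := loc_numdenP v t.
rewrite /loc_scale; move: e e'.
move: (loc_num (loc_frac a s)) (loc_den (loc_frac a s)) => b s'.
move: (loc_num (loc_frac v t)) (loc_den (loc_frac v t)) => w t' e e'.
apply/loc_fracP; exists (denomM u u'); rewrite !valE.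
transitivity ((val u * (val s * b)) *: (val u' *: (val t *: w))).
  by rewrite !scalerA; congr (_ *: _); ring.
have {}e : val u * (val s * b) = val u * (val s' * a) := e.
by rewrite e e' !scalerA; congr (_ *: _); ring.
Qed.

End Scale.

Definition loc_one : loc_ring := loc_frac (1 : R^o) denom1.
Definition loc_mul (a b : loc_ring) : loc_ring := loc_scale a b.

Lemma loc_mulE (a b : R^o) s t :
  loc_mul (loc_frac a s) (loc_frac b t) = loc_frac (a * b : R^o) (denomM s t).
Proof. exact: loc_scaleE. Qed.

Fact loc_mulA : associative loc_mul.
Proof.
elim/loc_frac_ind=> a s; elim/loc_frac_ind=> b t; elim/loc_frac_ind=> c r.
rewrite (loc_mulE b c) (loc_mulE a b) !loc_mulE; apply: eq_loc_frac.
by rewrite !valE /GRing.scale /=; ring.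
Qed.

Fact loc_mulC : commutative loc_mul.
Proof.
elim/loc_frac_ind=> a s; elim/loc_frac_ind=> b t.
by rewrite !loc_mulE; apply: eq_loc_frac; rewrite !valE /GRing.scale /=; ring.
Qed.

Fact loc_mul1 : left_id loc_one loc_mul.
Proof.
elim/loc_frac_ind=> a s.
by rewrite loc_mulE; apply: eq_loc_frac; rewrite !valE /GRing.scale /=; ring.
Qed.

Fact loc_mulDl : left_distributive loc_mul +%R.
Proof.
elim/loc_frac_ind=> a s; elim/loc_frac_ind=> b t; elim/loc_frac_ind=> c r.
rewrite loc_fracD !loc_mulE loc_fracD.
by apply: eq_loc_frac; rewrite !valE /GRing.scale /=; ring.
Qed.

Fact loc_one_neq0 : loc_one != 0.
Proof.
apply/eqP => /loc_fracP[u] /=; rewrite scaler0 scaler0 scale1r => u0.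
have {}u0 : val u = 0 by rewrite -[val u]mulr1.
by have := valP u; rewrite /= u0 idealr0.
Qed.

HB.instance Definition _ := GRing.Zmodule_isComNzRing.Build loc_ring
  loc_mulA loc_mulC loc_mul1 loc_mulDl loc_one_neq0.

Section LocLmodule.
Variable M : lmodType R.

Fact loc_scaleA (a b : loc_ring) (x : loc_mod M) :
  loc_scale a (loc_scale b x) = loc_scale (a * b) x.
Proof.
elim/loc_frac_ind: a => a s; elim/loc_frac_ind: b => b t.
elim/loc_frac_ind: x => v r; rewrite (loc_scaleE b t v r).
rewrite [_ * _](loc_mulE a b s t) !loc_scaleE.
by apply: eq_loc_frac; rewrite !valE !scalerA; congr (_ *: _); ring.
Qed.

Fact loc_scale1 : left_id (1 : loc_ring) (@loc_scale M).
Proof.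
elim/loc_frac_ind=> v s; rewrite -[X in loc_scale X]/loc_one loc_scaleE.
by apply: eq_loc_frac; rewrite !valE scale1r mul1r.
Qed.

Fact loc_scaleDr : right_distributive (@loc_scale M) +%R.
Proof.
elim/loc_frac_ind=> a s; elim/loc_frac_ind=> v t; elim/loc_frac_ind=> w r.
rewrite loc_fracD !loc_scaleE loc_fracD; apply: eq_loc_frac.
rewrite !valE !scalerDr !scalerA.
by congr (_ *: _ + _ *: _); ring.
Qed.

Fact loc_scaleDl (x : loc_mod M) : {morph (@loc_scale M)^~ x : a b / a + b}.
Proof.
elim/loc_frac_ind=> a s; elim/loc_frac_ind=> b t; elim/loc_frac_ind: x => v r.
rewrite [X in loc_scale X]loc_fracD !loc_scaleE loc_fracD; apply: eq_loc_frac.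
rewrite !valE !scalerDl !scalerDr !scalerA.
by congr (_ *: _ + _ *: _); rewrite /GRing.scale /=; ring.
Qed.

HB.instance Definition _ := GRing.Zmodule_isLmodule.Build loc_ring (loc_mod M)
  loc_scaleA loc_scale1 loc_scaleDr loc_scaleDl.

End LocLmodule.
End Localization.

Definition is_assoc_prime (R : comNzRingType) (M : lmodType R)
    (P : prime_ideal R) : Prop :=
  exists v : M, forall a : R, a \in P <-> a *: v = 0.

Definition Ass (R : comNzRingType) (i : nat) (M : lmodType R) :
    set (prime_ideal R) :=
  [set P | is_assoc_prime M P /\ has_height P i]%classic.

Section Chow.
Variables (R : comNzRingType) (i : nat).

Definition prime_of_dim : Type :=
  {P : prime_ideal R | `[< has_krull_dim {ideal_quot P} i >]}.

HB.instance Definition _ := Choice.on prime_of_dim.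

Definition cycles : zmodType := {freeg prime_of_dim}.

(* If infinitely many coefficients are nonzero, which cannot happen for [M]
   finitely generated over [R] Noetherian with [dim M <= i], this is 0. *)
Definition cycle_of (M : lmodType R) : cycles :=
  \sum_(P \in [set: prime_of_dim]%classic)
    << (length (loc_mod (val P) M))%:Z *g P >>.

(* [(R/Q) / x(R/Q)] *)
Definition quot_quot (Q : prime_ideal R) (x : R) : lmodType R :=
  quot_mod (multiples (quot_mod (ideal_submod Q)) x).

Definition div_cycle (Q : prime_ideal R) (x : R) : cycles :=
  cycle_of (quot_quot Q x).

(* The subgroup generated by all [div(Q, x)] with [dim R/Q = i+1], [x \notin Q] *)
Definition rat_equiv : {pred cycles} := fun z =>
  `[< forall H : zmodClosed cycles,
        (forall (Q : prime_ideal R) (x : R),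
          has_krull_dim {ideal_quot Q} i.+1 -> x \notin Q ->
          div_cycle Q x \in H) -> z \in H >].

Fact rat_equiv_closed : zmod_closed rat_equiv.
Proof.
split; first by apply/asboolP => H _; apply: rpred0.
move=> y z /asboolP ry /asboolP rz; apply/asboolP => H divH.
by apply: rpredB; [apply: ry | apply: rz].
Qed.

HB.instance Definition _ := GRing.isZmodClosed.Build cycles rat_equiv
  rat_equiv_closed.

Definition chow_group : zmodType := Quotient.quot rat_equiv.

End Chow.

Definition is_torsion (G : zmodType) : Prop :=
  forall g : G, exists2 n : nat, (0 < n)%N & g *+ n = 0.

Record is_grading (A : comNzRingType) (gr : nat -> set A) : Prop := IsGrading {
  grading_0 : forall n, gr n 0;
  grading_B : forall n a b, gr n a -> gr n b -> gr n (a - b);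
  grading_1 : gr 0%N 1;
  grading_M : forall m n a b, gr m a -> gr n b -> gr (m + n)%N (a * b);
  grading_span : forall a, exists (N : nat) (c : 'I_N -> A),
    (forall n : 'I_N, gr n (c n)) /\ a = \sum_(n < N) c n;
  grading_direct : forall (N : nat) (c : 'I_N -> A),
    (forall n : 'I_N, gr n (c n)) -> \sum_(n < N) c n = 0 -> forall n, c n = 0
}.

Section PolynomialSubring.
Variables (k : fieldType) (A : comNzRingType) (iota : {rmorphism k -> A}).
Variables (r : nat) (X : 'I_r -> A).

(* k[X_0, ..., X_(r-1)] inside [A] *)
Definition poly_subring : set A := range (mpoly.mmap iota X).

Definition algebraically_independent : Prop := injective (mpoly.mmap iota X).

End PolynomialSubring.

Definition finitely_generated_algebra (k : fieldType) (A : comNzRingType)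
    (iota : {rmorphism k -> A}) : Prop :=
  exists (r : nat) (x : 'I_r -> A), poly_subring iota x = [set: A]%classic.

Definition finite_over (A : comNzRingType) (T : set A) : Prop :=
  exists (r : nat) (s : 'I_r -> A), forall a : A,
    exists2 c : 'I_r -> A, (forall j, T (c j)) & a = \sum_(j < r) c j * s j.

(* [T = k[X_0, ..., X_(r-1)]] is a Noether normalization of the graded ring
   [A], and all the [X_j] have degree [m]. *)
Definition equidegree_noether_normalization (k : fieldType)
    (A : comNzRingType) (gr : nat -> set A) (iota : {rmorphism k -> A})
    (m r : nat) (X : 'I_r -> A) : Prop :=
  [/\ forall j, gr m (X j),
      algebraically_independent iota X
    & finite_over (poly_subring iota X)].

(* Main.v *)
(* Since [dim R = 2], the rational equivalences of 1-cycles are the [div(0, f)], [f <> 0].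

   If a prime [P] with [dim R/P = 1] contains a nonzero homogeneous element [h], then a
   coefficient of an equation of integral dependence of [h] over [T] gives a nonzero form
   [w(X_0, X_1)] in [P]; as [k] is algebraically closed, [w] is a product of linear forms,
   so that [P] contains some nonzero [xi] in [T_m].  Primes of [R] over [xi] lift to primes
   of [A] of height 1 associated to [A/xi A], hence [P] is the only prime of dimension 1
   containing [xi], and [div(0, xi)] is a positive multiple of [[R/P]].

   If [P] contains no nonzero homogeneous element, it becomes principal once homogeneous
   elements are inverted: for an [f] in [P] with the smallest spread of degrees and [l] its
   component of highest degree, every [g] in [P] satisfies [l^n g] in [f R] for some [n].
   The other primes of dimension 1 containing [f] contain the homogeneous element [l], so
   there are finitely many of them, their classes are torsion, and [div(0, f)] shows that
   [[R/P]] is torsion too.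

   [T] enters through the ring morphisms [coord_map] from [k[Y][X]], [X] being mapped to a
   linear form and [Y] to a complementary one: being divisible by the linear form is then
   having a zero constant term. *)
Require Import Defs.
From HB Require Import structures.
From mathcomp Require Import all_boot all_order all_algebra generic_quotient.
From mathcomp Require Import boolp classical_sets functions cardinality fsbigop.
From mathcomp Require Import freeg ring zify.
From mathcomp Require mpoly.

Set Implicit Arguments.
Unset Strict Implicit.
Unset Printing Implicit Defensive.

Import GRing.Theory.

Local Open Scope classical_set_scope.
Local Open Scope ring_scope.
Local Open Scope quotient_scope.

(** * Prime ideals and dimension *)

Lemma prime_ideal_of_set (B : comNzRingType) (S : set B) :
    S 0 -> ~ S 1 -> (forall a u v, S u -> S v -> S (a * u + v)) ->
    (forall u v, S (u * v) -> S u \/ S v) ->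
  exists P : prime_ideal B, forall x, x \in P <-> S x.
Proof.
move=> S0 S1 SL Sp; pose p x := `[< S x >].
have ip : idealr_closed p.
  split; rewrite ?unfold_in; [exact/asboolP | exact/asboolP |].
  move=> a u v /asboolP Su /asboolP Sv; exact/asboolP/SL.
have pp : prime_idealr_closed p.
  by move=> u v /asboolP/Sp[] h; apply/orP; [left|right]; apply/asboolP.
by exists (PrimeIdeal ip pp) => x; split=> /asboolP.
Qed.

Section Comap.
Variables (B C : comNzRingType) (f : {rmorphism B -> C}) (Q : prime_ideal C).

Let comap_pred : B -> bool := fun x => f x \in Q.

Let comapE x : (x \in (comap_pred : {pred B})) = (f x \in Q). Proof. by []. Qed.

Fact comap_ideal : idealr_closed comap_pred.
Proof.
split=> [||a u v]; rewrite !comapE ?rmorph0 ?rmorph1 ?rpred0 ?idealr1 //.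
by move=> fu fv; rewrite rmorphD rmorphM rpredD // idealMr.
Qed.

Fact comap_prime : prime_idealr_closed comap_pred.
Proof. by move=> u v; rewrite !comapE rmorphM prime_idealrM. Qed.

Definition comap : prime_ideal B := PrimeIdeal comap_ideal comap_prime.

Lemma mem_comap x : (x \in comap) = (f x \in Q). Proof. by []. Qed.
End Comap.

Lemma strict_subP (B : comNzRingType) (P Q : prime_ideal B) :
  strict_sub P Q <-> {subset P <= Q} /\ exists2 x, x \in Q & x \notin P.
Proof.
split=> [[PQ nQP]|[PQ [x xQ xP]]]; split=> //; last first.
  by move=> QP; rewrite QP in xP.
apply: contra_notP nQP => nex x xQ; apply: contrapT => /negP xP.
by apply: nex; exists x.
Qed.

Lemma strict_sub_trans (B : comNzRingType) (P Q S : prime_ideal B) :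
  strict_sub P Q -> strict_sub Q S -> strict_sub P S.
Proof.
by move=> [PQ nQP] [QS nSQ]; split=> [x /PQ/QS //|SP]; apply: nQP => x /QS/SP.
Qed.

Lemma subset_strict_sub (B : comNzRingType) (P Q : prime_ideal B) :
  {subset P <= Q} -> P <> Q -> strict_sub P Q.
Proof.
move=> PQ nPQ; split=> // QP; apply/nPQ/prime_ideal_inj => x.
by apply/idP/idP; [apply: PQ|apply: QP].
Qed.

(** Lets short explicit lists of primes be compared with a dimension or a height. *)
Lemma chain_of_path (B : comNzRingType) (P : prime_ideal B)
    (s : seq (prime_ideal B)) :
    path (fun P Q : prime_ideal B => `[< strict_sub P Q >]) P s ->
  exists C : 'I_(size s).+1 -> prime_ideal B,
    [/\ strict_chain (fun i => C i : {pred B}), C ord0 = P & C ord_max = last P s].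
Proof.
move=> Ps; exists (fun i => nth P (P :: s) i); split=> //=; last first.
  by rewrite nth_last; case: (s).
move=> i j ij; apply/asboolP.
have tr : transitive (fun P Q : prime_ideal B => `[< strict_sub P Q >]).
  by move=> Q P' S /asboolP h /asboolP h'; apply/asboolP/(strict_sub_trans h h').
by apply: (sorted_ltn_nth tr P (s := P :: s)) => //; rewrite inE /= ltn_ord.
Qed.

Lemma strict_chain_sub (T : Type) n (C : 'I_n.+1 -> {pred T}) :
  strict_chain C -> forall i j : 'I_n.+1, (i <= j)%N -> {subset C i <= C j}.
Proof.
move=> sC i j; rewrite leq_eqVlt => /orP[/eqP/val_inj -> //|/sC[] //].
Qed.

Section QuotientPrimes.
Variables (B : comNzRingType) (P : prime_ideal B).
Let pi : {rmorphism B -> {ideal_quot P}} := \pi_({ideal_quot P}).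

Let pi_eq0 x : (pi x == 0) = (x \in P).
Proof. by rewrite -(rmorph0 pi) -Quotient.idealrBE subr0. Qed.

Let piK x : pi (repr x) = x. Proof. exact: reprK. Qed.

Lemma quot_prime (Q : prime_ideal B) : {subset P <= Q} ->
  exists Q' : prime_ideal {ideal_quot P}, comap pi Q' = Q.
Proof.
move=> PQ.
have piQ x y : pi x = pi y -> (x \in Q) = (y \in Q).
  move/eqP; rewrite -subr_eq0 -rmorphB pi_eq0 => /PQ xyQ.
  by rewrite -[x](subrK y) rpredDl.
have reprQ x : (repr (pi x) \in Q) = (x \in Q) by apply: piQ; rewrite piK.
(* Membership of a class is tested on its representative; as [P] is contained in [Q], the choice of
   the representative does not matter. *)
have [||||Q' Q'P] := @prime_ideal_of_set {ideal_quot P} (fun x => repr x \in Q).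
- by rewrite -(rmorph0 pi) reprQ rpred0.
- by rewrite -(rmorph1 pi) reprQ idealr1.
- move=> a u v; rewrite -[a]piK -[u]piK -[v]piK -rmorphM -rmorphD !reprQ => h1 h2.
  by rewrite rpredD ?idealMr.
- move=> u v; rewrite -[u]piK -[v]piK -rmorphM !reprQ prime_idealrM => /orP[]; auto.
exists Q'; apply: prime_ideal_inj => x; rewrite mem_comap.
by apply/idP/idP => [/Q'P|h]; [|apply/Q'P]; rewrite reprQ.
Qed.

(** Preimages identify the ordered set of primes of the quotient with that of the primes containing
    [P]; for a chain, containing [P] is a condition on its lowest member. *)
Lemma krull_dim_quot d : has_krull_dim {ideal_quot P} d <->
  is_maximum (fun n => exists C : 'I_n.+1 -> prime_ideal B,
    strict_chain (fun i => C i : {pred B}) /\ {subset P <= C ord0}) d.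
Proof.
suff H n : (exists C : 'I_n.+1 -> prime_ideal {ideal_quot P},
    strict_chain (fun i => C i : {pred {ideal_quot P}})) <->
  (exists C : 'I_n.+1 -> prime_ideal B,
    strict_chain (fun i => C i : {pred B}) /\ {subset P <= C ord0}).
  by split=> -[/H h mh]; split=> // n /H /mh.
split=> [[C sC]|[C [sC PC]]].
  exists (fun i => comap pi (C i)); split=> [i j /sC[ss ns]|x xP].
    split=> [x|sb]; first exact: ss.
    by apply: ns => x; rewrite -[x]piK; apply: sb.
  by rewrite mem_comap; move: xP; rewrite -pi_eq0 => /eqP ->; rewrite rpred0.
have /choice[C' C'E] i : exists Q', comap pi Q' = C i.
  by apply: quot_prime => x /PC; apply: (strict_chain_sub sC).
exists C' => i j /sC; rewrite -!C'E => -[ss ns]; split=> [x|sb].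
  by rewrite -[x]piK; apply: ss.
by apply: ns => x; apply: sb.
Qed.

Hypothesis dimP : has_krull_dim {ideal_quot P} 1.

Lemma dim1_above : exists Q : prime_ideal B, strict_sub P Q.
Proof.
case/krull_dim_quot: dimP => -[C [sC PC]] _.
exists (C ord_max); apply/strict_subP.
have /strict_subP[ss [x x1 x0]] := sC ord0 ord_max isT.
by split=> [y /PC/ss //|]; exists x => //; apply: contra x0; apply: PC.
Qed.

Lemma dim1_above2 (Q S : prime_ideal B) : strict_sub P Q -> strict_sub Q S -> False.
Proof.
move=> PQ QS; case/krull_dim_quot: dimP => _ /(_ 2%N).
have [|C [sC C0 _]] := @chain_of_path B P [:: Q; S].
  by rewrite /= andbT; apply/andP; split; apply/asboolP.
move=> le21; suff: (2 <= 1)%N by [].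
by apply: le21; exists C; split=> //; rewrite C0.
Qed.

End QuotientPrimes.

Lemma dim1_eq (B : comNzRingType) (P Q : prime_ideal B) :
    has_krull_dim {ideal_quot P} 1 -> has_krull_dim {ideal_quot Q} 1 ->
  {subset P <= Q} -> P = Q.
Proof.
move=> dP dQ PQ; apply: contrapT => /(subset_strict_sub PQ) sPQ.
by have [S /(dim1_above2 dP sPQ)] := dim1_above dQ.
Qed.

Lemma mem_primeX (B : comNzRingType) (P : prime_ideal B) x n :
  x ^+ n \in P -> x \in P.
Proof.
elim: n => [|n IH]; first by rewrite expr0 idealr1.
by rewrite exprS prime_idealrM => /orP[|/IH].
Qed.

Lemma mem_prime_prod (B : comNzRingType) (P : prime_ideal B) (I : eqType)
    (s : seq I) (F : I -> B) :
  \prod_(i <- s) F i \in P -> exists2 i, i \in s & F i \in P.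
Proof.
elim: s => [|i s IH]; first by rewrite big_nil idealr1.
rewrite big_cons prime_idealrM => /orP[FP|/IH[j js FP]].
  by exists i => //; rewrite mem_head.
by exists j => //; rewrite inE js orbT.
Qed.

Lemma zero_prime (C : idomainType) :
  exists Z : prime_ideal C, forall x, (x \in Z) = (x == 0).
Proof.
have [|||u v|Z ZP] := @prime_ideal_of_set C (fun x => x = 0).
- by [].
- exact/eqP/oner_neq0.
- by move=> a u v -> ->; rewrite mulr0 addr0.
- by move/eqP; rewrite mulf_eq0 => /orP[]/eqP; auto.
by exists Z => x; apply/idP/eqP => /ZP.
Qed.

(** * Integral extensions *)

Lemma integral_eqn (B C : nzRingType) (f : {rmorphism B -> C}) z :
    integralOver f z ->
  exists n (c : nat -> B), z ^+ n = \sum_(i < n) f (c i) * z ^+ i.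
Proof.
case=> p p1 /rootP; rewrite horner_coef size_map_poly_id0; last first.
  by rewrite (monicP p1) rmorph1 oner_neq0.
have : (0 < size p)%N by rewrite size_poly_gt0 monic_neq0.
case E : (size p) => [//|n] _; rewrite big_ord_recr /= coef_map /=.
rewrite (_ : p`_n = 1) ?rmorph1 ?mul1r; last first.
  by rewrite -(monicP p1) lead_coefE E.
move=> /eqP; rewrite addrC addr_eq0 => /eqP zn.
exists n, (fun i => - p`_i); rewrite zn -sumrN; apply: eq_bigr => i _.
by rewrite coef_map rmorphN mulNr.
Qed.

Section GoingUp.
Variables (B C : comNzRingType) (f : {rmorphism B -> C}).
Hypothesis fint : forall z, integralOver f z.

(** By Zorn, some ideal [J] is maximal among those that contain [J0] and contract into [P];
    maximality makes it prime, and integrality makes its contraction all of [P]. With [J0 = 0] this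
    is lying over, with [J0] a prime it is going up. *)
Lemma going_up (P : prime_ideal B) (J0 : set C) :
    J0 0 -> (forall a u v, J0 u -> J0 v -> J0 (a * u + v)) ->
    (forall b, J0 (f b) -> b \in P) ->
  exists Q : prime_ideal C, (forall x, J0 x -> x \in Q) /\ comap f Q = P.
Proof.
move=> J00 J0L J0P.
pose good (X : set C) := [/\ J0 `<=` X,
  (forall a u v, X u -> X v -> X (a * u + v)) & forall b, X (f b) -> b \in P].
(* [good] is required of nonempty sets only, because the union of an empty chain is empty. *)
have [|J [Jgood Jmax]] := @Zorn_bigcup C (fun X => X !=set0 -> good X).
  move=> F Fgood Ftot /= [x0 [X0 FX0 X0x0]].
  have goodF X x : F X -> X x -> good X by move=> /Fgood gX Xx; apply: gX; exists x.
  split=> [x J0x|a u v [X FX Xu] [Y FY Yv]|b [X FX Xb]].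
  - by exists X0 => //; have [+ _ _] := goodF _ _ FX0 X0x0; apply.
  - have [XY|YX] := Ftot _ _ FX FY.
      by exists Y => //; have [_ + _] := goodF _ _ FY Yv; apply=> //; apply: XY.
    by exists X => //; have [_ + _] := goodF _ _ FX Xu; apply=> //; apply: YX.
  by have [_ _] := goodF _ _ FX Xb; apply.
have J0good : good J0 by split.
have Jn0 : J !=set0.
  apply: contrapT => J0'; apply: (Jmax J0) => //; split; last first.
    by move=> J0J; apply: J0'; exists 0; exact: J0J.
  by move=> x Jx; case: J0'; exists x.
have {Jn0 Jgood} [J0J JL JP] := Jgood Jn0.
have JM a u : J u -> J (a * u).
  by move=> Ju; rewrite -[a * u]addr0; apply: JL => //; apply: J0J.
(* By maximality, the ideal generated by [J] and an [x] outside [J] no longer contracts into [P]. *)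
have Jmeet x : ~ J x -> exists j a s, [/\ J j, j + a * x = f s & s \notin P].
  move=> nJx; apply: contrapT => nmeet.
  apply: (Jmax [set y | exists j a, J j /\ y = j + a * x]).
    split=> [y Jy|sJ]; first by exists y, 0; rewrite mul0r addr0.
    apply/nJx/sJ; exists 0, 1; rewrite mul1r add0r; split=> //; exact: J0J.
  move=> _; split.
  - by move=> y /J0J Jy; exists y, 0; rewrite mul0r addr0.
  - move=> a _ _ [j [b [Jj ->]]] [j' [b' [Jj' ->]]].
    exists (a * j + j'), (a * b + b'); split; [exact: JL|ring].
  - move=> b [j [a [Jj e]]]; apply: contrapT => /negP bP; apply: nmeet.
    by exists j, a, b.
have [||||Q QJ] := @prime_ideal_of_set C J.
- exact: J0J.
- by move=> J1; have := JP 1; rewrite rmorph1 idealr1 => /(_ J1).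
- by [].
- move=> u v Juv; apply: contrapT => /not_orP[/Jmeet[j [a [s [Jj es sP]]]]].
  move=> /Jmeet[j' [a' [s' [Jj' es' sP']]]].
  have : s * s' \in P.
    apply: JP; rewrite rmorphM -es -es'.
    have -> : (j + a * u) * (j' + a' * v) =
      (j' + a' * v) * j + (a * u * j' + a * a' * (u * v)) by ring.
    by apply: (JL) => //; apply: JL => //; apply: JM.
  by rewrite prime_idealrM (negPf sP) (negPf sP').
exists Q; split=> [x /J0J/QJ //|]; apply: prime_ideal_inj => p; rewrite mem_comap.
apply/idP/idP => [/QJ/JP //|pP]; apply: contrapT => /negP fpQ.
(* Modulo [Q], [f s] is [a * f p]. Multiplying the equation of [a] by [f p ^+ n] gives an equation
   of [s] modulo [P] whose lower coefficients are multiples of [p], so that [s ^+ n] would be in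
   [P]. *)
have /Jmeet[j [a [s [/QJ jQ es /negP sP]]]] : ~ J (f p) by move=> /QJ; exact/negP.
have [n [c an]] := integral_eqn (fint a).
have sQ i : f s ^+ i - (a * f p) ^+ i \in Q.
  by rewrite subrXX -es addrK mulrC idealMr.
have : s ^+ n - \sum_(i < n) c i * p ^+ (n - i) * s ^+ i \in P.
  apply/JP/QJ; rewrite rmorphB rmorphXn rmorph_sum /=.
  have -> : \sum_(i < n) f (c i * p ^+ (n - i) * s ^+ i) =
    \sum_(i < n) f (c i * p ^+ (n - i)) * (f s ^+ i - (a * f p) ^+ i) + (a * f p) ^+ n.
    rewrite exprMn an mulr_suml -big_split /=; apply: eq_bigr => i _.
    have -> : f p ^+ n = f p ^+ (n - i) * f p ^+ i by rewrite -exprD subnK // ltnW.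
    by rewrite !rmorphM !rmorphXn /= exprMn; ring.
  rewrite addrC opprD addrAC -addrA rpredD // 1?addrC ?sQ // rpredN.
  by apply: rpred_sum => i _; apply: idealMr.
rewrite rpredBr ?rpredN; first by move=> /mem_primeX.
apply: rpred_sum => i _; rewrite mulrAC idealMr //.
by rewrite -(subnSK (ltn_ord i)) exprS mulrC idealMr.
Qed.

(** Incomparability. Take an [x] in [Q2] outside [Q1] and its integral equation modulo [Q1]: as long
    as the constant term is in [Q1], the equation can be divided by [x]; the first constant term
    outside [Q1] is in [Q2]. *)
Lemma comap_strict_sub (Q1 Q2 : prime_ideal C) :
  strict_sub Q1 Q2 -> strict_sub (comap f Q1) (comap f Q2).
Proof.
move=> /strict_subP[Q12 [x xQ2 xQ1]]; apply/strict_subP; split=> [b|].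
  by rewrite !mem_comap; apply: Q12.
have [n [c xn]] := integral_eqn (fint x).
have {xn} : x ^+ n - \sum_(i < n) f (c i) * x ^+ i \in Q1 by rewrite xn subrr rpred0.
elim: n c => [|n IH] c; first by rewrite big_ord0 subr0 expr0 idealr1.
rewrite big_ord_recl expr0 mulr1 /= => h.
have E : \sum_(i < n) f (c (bump 0 i)) * x ^+ bump 0 i =
    x * \sum_(i < n) f (c i.+1) * x ^+ i.
  by rewrite mulr_sumr; apply: eq_bigr => i _; rewrite /bump /= add1n exprS; ring.
have [c0|c0] := boolP (f (c 0%N) \in Q1); last first.
  exists (c 0%N); rewrite !mem_comap //.
  have -> : f (c 0%N) = x * (x ^+ n - \sum_(i < n) f (c i.+1) * x ^+ i) -
     (x ^+ n.+1 - (f (c 0%N) + \sum_(i < n) f (c (bump 0 i)) * x ^+ bump 0 i)).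
    by rewrite E exprS; ring.
  by rewrite rpredB ?(Q12 _ h) // mulrC idealMr.
apply: (IH (fun i => c i.+1)).
have : x * (x ^+ n - \sum_(i < n) f (c i.+1) * x ^+ i) \in Q1.
  have -> : x * (x ^+ n - \sum_(i < n) f (c i.+1) * x ^+ i) =
    f (c 0%N) + (x ^+ n.+1 - (f (c 0%N) + \sum_(i < n) f (c (bump 0 i)) * x ^+ bump 0 i)).
    by rewrite E exprS; ring.
  exact: rpredD.
by rewrite prime_idealrM (negPf xQ1).
Qed.

Hypothesis finj : injective f.

Lemma lying_over (P : prime_ideal B) : exists Q : prime_ideal C, comap f Q = P.
Proof.
have [|||Q [_ QP]] := @going_up P [set 0]; last by exists Q.
- by [].
- by move=> a u v -> ->; rewrite mulr0 addr0.
- by move=> b; rewrite -(rmorph0 f) => /finj ->; rewrite rpred0.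
Qed.

Lemma lift_strict_chain n (D : 'I_n.+1 -> prime_ideal B) :
    strict_chain (fun i => D i : {pred B}) ->
  exists E : 'I_n.+1 -> prime_ideal C, strict_chain (fun i => E i : {pred C}).
Proof.
move=> sD.
(* [up P Q] is the prime over [P] that going up provides above [Q]; it defaults to [Q] if [Q] does
   not contract into [P]. *)
have [up upP] : exists up : prime_ideal B -> prime_ideal C -> prime_ideal C,
    forall (P : prime_ideal B) (Q : prime_ideal C), {subset comap f Q <= P} ->
      {subset Q <= up P Q} /\ comap f (up P Q) = P.
  have /choice[up upP] (PQ : prime_ideal B * prime_ideal C) :
    exists Q' : prime_ideal C, {subset comap f PQ.2 <= PQ.1} ->
      {subset PQ.2 <= Q'} /\ comap f Q' = PQ.1.
    have [sub|nsub] := pselect {subset comap f PQ.2 <= PQ.1}; last by exists PQ.2.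
    have [|||Q [QQ QP]] := @going_up PQ.1 [set x | x \in PQ.2].
    - exact: rpred0.
    - by move=> a u v /= au av; rewrite rpredD ?idealMr.
    - by move=> b /= hb; apply: sub; rewrite mem_comap.
    by exists Q => _.
  by exists (fun P Q => up (P, Q)) => P Q; apply: (upP (P, Q)).
have [E0 E0P] := lying_over (D ord0).
pose E := fix E i := if i is j.+1 then up (D (inord j.+1)) (E j) else E0.
have EP i : (i < n.+1)%N -> comap f (E i) = D (inord i).
  elim: i => [_|i IH lin] /=.
    by rewrite E0P; congr D; apply: val_inj; rewrite /= inordK.
  have lin' := ltnW lin; have [|_ -> //] := upP (D (inord i.+1)) (E i).
  by rewrite (IH lin'); apply: (strict_chain_sub sD); rewrite !inordK.
have EE i : (i.+1 < n.+1)%N -> {subset E i <= E i.+1}.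
  move=> lin; have lin' := ltnW lin.
  have [|//] := upP (D (inord i.+1)) (E i).
  by rewrite (EP _ lin'); apply: (strict_chain_sub sD); rewrite !inordK.
have Ele i j : (i <= j < n.+1)%N -> {subset E i <= E j}.
  elim: j => [|j IH]; first by case: i => [_ x|].
  rewrite leq_eqVlt => /andP[/orP[/eqP ->|ij] jn] x xE //.
  by apply: (EE j jn); apply: IH => //; rewrite -ltnS ij (ltnW jn).
exists (fun i => E i) => i j ij; split=> [|sE].
  by apply: Ele; rewrite (ltnW ij) ltn_ord.
have [_] := sD i j ij; apply=> x.
rewrite -[i]inord_val -[j]inord_val -!EP ?ltn_ord // !mem_comap; exact: sE.
Qed.

(** Chains of [C] contract to strict chains by incomparability, and chains of [B] lift by going
    up. *)
Lemma krull_dim_integral d : has_krull_dim C d -> has_krull_dim B d.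
Proof.
move=> [[D sD] maxd]; split=> [|n [E /lift_strict_chain]]; last exact: maxd.
by exists (fun i => comap f (D i)) => i j /sD/comap_strict_sub.
Qed.

End GoingUp.

(** The zero ideal lies strictly below [Q]. A chain of length 2 ending at [Q] would contract to a
    chain which a prime strictly above [comap f Q] extends to length 3, against [dim B = 2]. *)
Lemma height1_over (B : comNzRingType) (C : idomainType) (f : {rmorphism B -> C})
    (Q : prime_ideal C) x :
    (forall z, integralOver f z) -> has_krull_dim B 2 ->
    has_krull_dim {ideal_quot (comap f Q)} 1 -> x != 0 -> x \in Q ->
  has_height Q 1.
Proof.
move=> fint [_ maxB] /dim1_above[P' sP'] x0 xQ.
have [Z ZP] := zero_prime C.
have ZQ : strict_sub Z Q.
  apply/strict_subP; split=> [y|]; first by rewrite ZP => /eqP ->; rewrite rpred0.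
  by exists x => //; rewrite ZP.
split.
  have [|D [sD _ DQ]] := @chain_of_path C Z [:: Q].
    by rewrite /= andbT; apply/asboolP.
  by exists D; split=> // y; rewrite DQ.
move=> n [D [sD DQ]]; rewrite leqNgt; apply/negP => n1.
have {}DQ : D ord_max = Q by apply: prime_ideal_inj.
have [|E [sE _ _]] := @chain_of_path B (comap f (D ord0))
    [:: comap f (D (inord 1)); comap f Q; P'].
  have lt1n : (1 < n.+1)%N := ltnW n1.
  rewrite /= andbT; apply/and3P; split; apply/asboolP => //.
    by apply/(comap_strict_sub fint)/sD; rewrite /= inordK.
  by rewrite -DQ; apply/(comap_strict_sub fint)/sD; rewrite /= inordK.
suff: (3 <= 2)%N by [].
by apply: maxB; exists E.
Qed.

(** * Finite extensions of polynomial rings *)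

(** Fraction-free Gaussian elimination: clearing the first column and dropping the pivot row leaves
    a matrix of the same shape, with one row more than columns. *)
Lemma exists_kernel_vector (D : idomainType) r (M : 'I_r.+1 -> 'I_r -> D) :
  exists2 t : 'I_r.+1 -> D, exists i, t i != 0 &
    forall j, \sum_i t i * M i j = 0.
Proof.
elim: r M => [|r IH] M.
  by exists (fun=> 1) => [|[]//]; exists ord0; exact: oner_neq0.
(* The pivot [a] is a nonzero entry of the first column; if the column vanishes, row 0 with [a = 1]
   does. *)
have [p [a [a0 aM]]] : exists (p : 'I_r.+2) (a : D),
    a != 0 /\ forall i, a * M i ord0 = M p ord0 * M i ord0.
  have [[p Mp]|M0] := pselect (exists p, M p ord0 != 0); first by exists p, (M p ord0).
  exists ord0, 1; split=> [|i]; first exact: oner_neq0.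
  have -> : M i ord0 = 0; last by rewrite !mulr0.
  by apply/eqP; apply: contrapT => /negP Mi; apply: M0; exists i.
pose N i j := a * M (fintype.lift p i) (fintype.lift ord0 j) -
  M (fintype.lift p i) ord0 * M p (fintype.lift ord0 j).
have [t [i0 ti0] tN] := IH N.
(* The coefficient of the pivot row is chosen so that [u] combines the rows of [M] as [t] combines
   those of [N]. *)
pose u i := if unlift p i is Some i' then a * t i'
  else - \sum_i' t i' * M (fintype.lift p i') ord0.
have uM j : \sum_i u i * M i j =
    \sum_i' (a * (t i' * M (fintype.lift p i') j) -
              t i' * M (fintype.lift p i') ord0 * M p j).
  rewrite (bigD1_ord p) //= {1}/u unlift_none addrC sumrB mulNr mulr_suml.
  by congr (_ - _); apply: eq_bigr => i _; rewrite /u liftK mulrA.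
exists u; first by exists (fintype.lift p i0); rewrite /u liftK mulf_neq0.
move=> j; rewrite uM; case: (unliftP ord0 j) => [j' ->|->].
  by rewrite -[RHS](tN j'); apply: eq_bigr => i _; rewrite /N; ring.
by rewrite big1 // => i _; rewrite [a * _]mulrCA aM; ring.
Qed.

Section FiniteExtension.
Variables (D : comNzRingType) (C : comNzRingType) (phi : {rmorphism D -> C}).
Variables (r : nat) (s : 'I_r -> C).
Hypothesis span : forall a, exists c : 'I_r -> D, a = \sum_(j < r) phi (c j) * s j.

(** The determinant trick: multiplication by [a] has a matrix [M] on the generators [s], and the
    determinant of [a - M] kills every [s i], hence also 1, which is a combination of them. *)
Lemma finite_integral a : integralOver phi a.
Proof.
have /choice[c cE] i : exists c : 'I_r -> D, a * s i = \sum_(j < r) phi (c j) * s j.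
  exact: span.
pose M : 'M[D]_r := \matrix_(i, j) c i j.
exists (char_poly M); first exact: char_poly_monic.
rewrite map_char_poly; apply/eqP.
pose N := a%:M - map_mx phi M; pose v : 'cV[C]_r := \col_i s i.
have -> : (char_poly (map_mx phi M)).[a] = \det N.
  rewrite -horner_evalE -det_map_mx; congr (\det _).
  apply/matrixP => i j; rewrite /char_poly_mx !mxE /= /horner_eval.
  by rewrite hornerD hornerN hornerMn hornerX hornerC.
have Nv : N *m v = 0.
  apply/matrixP => i j; rewrite mulmxBl mul_scalar_mx !mxE cE; apply/eqP.
  by rewrite subr_eq0; apply/eqP/eq_bigr => l _; rewrite !mxE.
have detv : \det N *: v = 0 by rewrite -mul_scalar_mx -mul_adj_mx -mulmxA Nv mulmx0.
have [d dE] := span 1; rewrite -[LHS]mulr1 dE mulr_sumr big1 // => i _.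
by rewrite mulrCA; have /matrixP/(_ i ord0) := detv; rewrite !mxE => ->; rewrite mulr0.
Qed.
End FiniteExtension.

Lemma finite_dependent (D : idomainType) (C : comNzRingType) (phi : {rmorphism D -> C})
    r (s : 'I_r -> C) (b : 'I_r.+1 -> C) :
    (forall a, exists c : 'I_r -> D, a = \sum_(j < r) phi (c j) * s j) ->
  exists2 t : 'I_r.+1 -> D, exists i, t i != 0 & \sum_i phi (t i) * b i = 0.
Proof.
move=> span; have /choice[c cE] i := span (b i).
have [t t0 tc] := exists_kernel_vector c; exists t => //.
under eq_bigr => i _ do rewrite cE mulr_sumr.
rewrite exchange_big big1 //= => j _.
under eq_bigr => i _ do rewrite mulrA -rmorphM.
by rewrite -mulr_suml -rmorph_sum tc rmorph0 mul0r.
Qed.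

Lemma polyXdiv (E : nzRingType) (p : {poly E}) : p`_0 = 0 -> exists q, p = q * 'X.
Proof.
move=> p0; exists (\poly_(i < size p) p`_i.+1); apply/polyP => i.
rewrite coefMX coef_poly; case: i => [//|i] /=; case: ifP => // /negbT.
by rewrite -leqNgt => /leqW /(nth_default 0).
Qed.

(* A relation can be divided by ['X] until some coefficient is not a multiple of ['X]. *)
Lemma finite_dependent_poly (E : idomainType) (C : idomainType)
    (phi : {rmorphism {poly E} -> C}) r (s : 'I_r -> C) (b : 'I_r.+1 -> C) :
    (forall a, exists c : 'I_r -> {poly E}, a = \sum_(j < r) phi (c j) * s j) ->
    phi 'X != 0 ->
  exists2 t : 'I_r.+1 -> {poly E}, exists i, (t i)`_0 != 0 & \sum_i phi (t i) * b i = 0.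
Proof.
move=> span phiX; have [t [i0 ti0] tb] := finite_dependent b span.
have [n] := ubnP (size (t i0)); elim: n t ti0 tb => // n IH t ti0 tb tn.
have [[i ti]|t0] := pselect (exists i, (t i)`_0 != 0); first by exists t => //; exists i.
have /choice[u uE] i : exists q, t i = q * 'X.
  by apply: polyXdiv; apply/eqP; apply: contrapT => /negP ti; apply: t0; exists i.
have u0 : u i0 != 0 by apply: contra_neq ti0; rewrite uE => ->; rewrite mul0r.
apply: (IH u u0).
  apply/eqP; rewrite -(mulrI_eq0 _ (lregP phiX)) mulr_sumr -[X in _ == X]tb.
  by apply/eqP/eq_bigr => i _; rewrite uE rmorphM mulrA; congr (_ * _); rewrite mulrC.
by move: tn; rewrite uE size_mulX.
Qed.

(** * Lengths of localizations *)

Section QuotMod.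
Variables (B : comNzRingType) (M : lmodType B) (N : submodClosed M).

Definition to_quot_mod (v : M) : quot_mod N := \pi_({ideal_quot (submod_pred N)}) v.

Lemma scale_to_quot_mod a v : a *: to_quot_mod v = to_quot_mod (a *: v).
Proof. exact: pi_quot_scale. Qed.

Lemma to_quot_mod_eq0 v : to_quot_mod v = 0 <-> v \in N.
Proof.
have -> : (v \in N) = (v - 0 \in submod_pred N) by rewrite subr0.
rewrite Quotient.idealrBE.
have -> : 0 = to_quot_mod 0 by rewrite /to_quot_mod raddf0.
by split=> /eqP.
Qed.

Lemma to_quot_mod_surj x : exists v, x = to_quot_mod v.
Proof.
by exists (repr (x : {ideal_quot (submod_pred N)})); rewrite /to_quot_mod reprK.
Qed.

End QuotMod.

(** All that is used afterwards of the module defining [div_cycle]: it is cyclic, generated by the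
    class of 1, with annihilator [Q + xB]. *)
Lemma quot_quot_cyclic (B : comNzRingType) (Q : prime_ideal B) x :
  exists e : quot_quot Q x, (forall v, exists b, v = b *: e) /\
    forall b : B, b *: e = 0 <-> exists c, b - x * c \in Q.
Proof.
exists (to_quot_mod _ (to_quot_mod (ideal_submod Q) (1 : B^o))); split=> [v|b].
  have [v' ->] := to_quot_mod_surj v; have [b ->] := to_quot_mod_surj v'.
  exists b; rewrite !scale_to_quot_mod; congr (to_quot_mod _ (to_quot_mod _ _)).
  by rewrite /GRing.scale /= mulr1.
rewrite !scale_to_quot_mod to_quot_mod_eq0.
have E c : b *: (1 : B^o) - x *: c = b - x * c by rewrite /GRing.scale /= mulr1.
have Es (c : B^o) : to_quot_mod (ideal_submod Q) (b *: (1 : B^o)) =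
    x *: to_quot_mod (ideal_submod Q) c <-> b - x * c \in Q.
  rewrite -(E c) scale_to_quot_mod.
  change (b *: (1 : B^o) - x *: c \in Q)
    with (b *: (1 : B^o) - x *: c \in ideal_submod Q).
  rewrite -to_quot_mod_eq0 /to_quot_mod raddfB; split=> [eb|/subr0_eq //].
  by apply/eqP; rewrite subr_eq0; apply/eqP.
split=> [/asboolP[w we]|[c bc]].
  by have [c wc] := to_quot_mod_surj w; exists c; apply/Es; rewrite -wc.
by apply/asboolP; exists (to_quot_mod _ (c : B^o)); apply/Es.
Qed.

Section LocLength.
Variables (B : comNzRingType) (P : prime_ideal B) (M : lmodType B).
Local Notation "v // s" := (loc_frac (P := P) (v : M) s) (at level 40).
Local Notation one := (denom1 P).

Section Submodule.
Variable C : submodClosed (loc_mod P M).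

Let scale_frac (a : B) (v : M) s :
  (loc_frac (a : B^o) one : loc_ring P) *: (v // s) = (a *: v) // s.
Proof.
rewrite [LHS](@loc_scaleE B P M (a : B^o) one v s); apply: eq_loc_frac.
by rewrite val_denomM val_denom1 mul1r.
Qed.

Lemma loc_mem_scale a v s : v // s \in C -> (a *: v) // s \in C.
Proof. by rewrite -scale_frac; apply: rpredZ. Qed.

Lemma loc_mem_unscale u v : u \notin P -> (u *: v) // one \in C -> v // one \in C.
Proof.
move=> uP uvC; have := @rpredZ _ _ C (loc_frac (1 : B^o) (Sub u uP : denom P)) _ uvC.
rewrite [_ *: _](@loc_scaleE B P M (1 : B^o) (Sub u uP) (u *: v) one).
congr (_ \in C); apply: eq_loc_frac.
by rewrite val_denomM val_denom1 !scale1r mulr1.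
Qed.

(** Denominators are units of the localization, so that a submodule is determined by the numerators
    it contains. *)
Lemma loc_mem_denom v s : (v // s \in C) = (v // one \in C).
Proof.
apply/idP/idP => [vsC|v1C].
  apply: (loc_mem_unscale (valP s)).
  rewrite (_ : (val s *: v) // one = (val s *: (val s *: v)) // s).
    by do 2!apply: loc_mem_scale.
  by apply: eq_loc_frac; rewrite val_denom1 scale1r.
apply: contrapT => vsC.
have := @rpredZ _ _ C (loc_frac (1 : B^o) s) _ v1C.
rewrite [_ *: _](@loc_scaleE B P M (1 : B^o) s v one) scale1r.
rewrite (_ : v // _ = v // s) // ; apply: eq_loc_frac.
by rewrite val_denomM val_denom1 mulr1.
Qed.

Lemma loc_mem_add v w : v // one \in C -> w // one \in C -> (v + w) // one \in C.
Proof.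
move=> vC wC; have := rpredD vC wC; rewrite loc_fracD val_denom1 !scale1r.
by rewrite loc_mem_denom.
Qed.

Lemma loc_mem_sum (I : Type) (s : seq I) (Q : pred I) (v : I -> M) :
  (forall i, Q i -> v i // one \in C) -> (\sum_(i <- s | Q i) v i) // one \in C.
Proof.
move=> vC; apply: (big_ind (fun v => v // one \in C)) => //.
  exact: rpred0.
exact: loc_mem_add.
Qed.

End Submodule.

Lemma loc_frac_eq0 v : v // one = 0 <-> exists2 u, u \notin P & u *: v = 0.
Proof.
split=> [/loc_fracP[u]|[u uP uv]]; last first.
  by apply/loc_fracP; exists (Sub u uP); rewrite !scaler0 val_denom1 scale1r.
by rewrite !scaler0 val_denom1 scale1r => uv; exists (val u); first exact: (valP u).
Qed.

Variables (e : M) (r : nat).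
Hypothesis Me : forall v, exists b, v = b *: e.
Hypothesis Mdep : forall b : 'I_r.+1 -> B, exists i u c, u \notin P /\
  (u * b i - \sum_(j < r.+1 | (j < i)%N) c j * b j) *: e = 0.

(** In a longer chain, each of the first [r.+1] steps gains some [b i *: e]. By [Mdep] one of these
    is, up to a unit [u], a combination of earlier ones, hence already in [C i]. *)
Lemma loc_chain_bound n (C : 'I_n.+1 -> submodClosed (loc_mod P M)) :
  strict_chain (fun i => C i : {pred loc_mod P M}) -> (n <= r)%N.
Proof.
move=> sC; rewrite leqNgt; apply/negP => rn.
have ltn1 (i : 'I_r.+1) : (i.+1 < n.+1)%N by rewrite ltnS (leq_trans (ltn_ord i)).
have /choice[b bP] (i : 'I_r.+1) : exists b : B,
    (b *: e) // one \in C (inord i.+1) /\ (b *: e) // one \notin C (inord i).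
  have [ss nss] : strict_sub (C (inord i)) (C (inord i.+1)).
    by apply: sC; rewrite !inordK // ltnW.
  apply: contrapT => nb; apply: nss => x.
  elim/loc_frac_ind: x => v s; have [b ->] := Me v; rewrite !loc_mem_denom => h.
  by apply: contrapT => /negP h'; apply: nb; exists b.
have [i [u [c [uP ube]]]] := Mdep b.
have /negP[] := (bP i).2; apply: (loc_mem_unscale uP); rewrite scalerA.
move: ube; rewrite scalerBl => /subr0_eq ->; rewrite scaler_suml.
apply: loc_mem_sum => j ji; rewrite -scalerA; apply: loc_mem_scale.
apply: (strict_chain_sub sC _ (bP j).1).
by rewrite !inordK // ltnW.
Qed.

(** Bounded chains have a maximal length, so [length] does not take its default value. *)
Lemma loc_has_length : has_length (loc_mod P M) (length (loc_mod P M)).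
Proof.
pose chains n := `[< exists C : 'I_n.+1 -> submodClosed (loc_mod P M),
  strict_chain (fun i => C i : {pred loc_mod P M}) >].
have [||l /asboolP hl ml] := @ex_maxnP chains r.
- exists 0%N; apply/asboolP.
  exists (fun=> [the submodClosed _ of multiples (loc_mod P M) (0 : loc_ring P)]).
  by move=> i j; rewrite !ord1.
- by move=> n /asboolP[C /loc_chain_bound].
rewrite /length; case: xgetP => [//|/(_ l)[]].
by split=> // n hn; apply: ml; apply/asboolP.
Qed.

Lemma length_loc_le : (length (loc_mod P M) <= r)%N.
Proof. by have [[C /loc_chain_bound]] := loc_has_length. Qed.

Lemma length_loc_gt0 : (forall b, b *: e = 0 -> b \in P) -> (0 < length (loc_mod P M))%N.
Proof.
move=> annP; have [_] := loc_has_length; apply.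
(* The multiples of 0 and of 1 are the zero submodule and the whole module; they differ because no
   element outside [P] kills [e]. *)
exists (fun i => [the submodClosed _ of
  multiples (loc_mod P M) ((i : nat)%:R : loc_ring P)]) => i j.
case: i j => [[|[|//]] i2] [[|[|//]] j2] //= _; split=> [x _|sub].
  by apply/asboolP; exists x; rewrite scale1r.
have /sub/asboolP[w] : e // one \in multiples (loc_mod P M) (1 : loc_ring P).
  by apply/asboolP; exists (e // one); rewrite scale1r.
rewrite mulr0n scale0r => /loc_frac_eq0[u /negP uP ue]; exact/uP/annP.
Qed.

End LocLength.

(** * Torsion cycles *)

Section TorsionCycles.
Variables (B : comNzRingType) (Z : prime_ideal B).
Hypotheses (Z0 : forall x, x \in Z -> x = 0) (dimZ : has_krull_dim {ideal_quot Z} 2).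

Definition torsion_cycle (z : cycles B 1) : Prop :=
  exists2 n, (0 < n)%N & z *+ n \in @rat_equiv B 1.

Lemma torsion_cycle0 : torsion_cycle 0.
Proof. by exists 1%N => //; rewrite mul0rn rpred0. Qed.

Lemma torsion_cycleB y z : torsion_cycle y -> torsion_cycle z -> torsion_cycle (y - z).
Proof.
move=> [n n0 yn] [l l0 zl]; exists (n * l)%N; first by rewrite muln_gt0 n0.
by rewrite mulrnBl mulrnA (mulnC n) mulrnA rpredB // rpredMn.
Qed.

Lemma torsion_cycleD y z : torsion_cycle y -> torsion_cycle z -> torsion_cycle (y + z).
Proof.
move=> ty tz; rewrite -[z]opprK; apply: torsion_cycleB => //.
by rewrite -[- z]sub0r; apply: torsion_cycleB => //; exact: torsion_cycle0.
Qed.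

Lemma torsion_cycle_sum (I : eqType) (s : seq I) (Q : pred I) (F : I -> cycles B 1) :
    (forall i, i \in s -> Q i -> torsion_cycle (F i)) ->
  torsion_cycle (\sum_(i <- s | Q i) F i).
Proof.
move=> tF; rewrite big_seq_cond; apply: (big_ind torsion_cycle) => [||i /andP[is_ Qi]].
- exact: torsion_cycle0.
- exact: torsion_cycleD.
- exact: tF.
Qed.

Lemma torsion_cycleMn z n : (0 < n)%N -> torsion_cycle (z *+ n) -> torsion_cycle z.
Proof.
by move=> n0 [l l0 h]; exists (n * l)%N; rewrite ?muln_gt0 ?n0 // mulrnA.
Qed.

Lemma torsion_cycle_point k (P : prime_of_dim B 1) :
  torsion_cycle << P >> -> torsion_cycle << k *g P >>.
Proof.
move=> [n n0 tP]; exists n => //.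
by rewrite -[k]intz -freegU_mulz -[_ *+ n]/(_ *~ n%:Z) mulrzAC rpredMz.
Qed.

Lemma chow_group_torsion : (forall P : prime_of_dim B 1, torsion_cycle << P >>) ->
  is_torsion (chow_group B 1).
Proof.
move=> tP g; have [n n0 tg] : torsion_cycle (repr g).
  rewrite -[X in torsion_cycle X]freeg_sumE; apply: torsion_cycle_sum => P _ _.
  exact: torsion_cycle_point.
exists n => //; rewrite -[g]reprK -raddfMn; apply/eqP.
rewrite -(raddf0 (\pi_(chow_group B 1))).
by rewrite -Quotient.idealrBE subr0.
Qed.

(* This bounds the length of [(B/FB)_P] by [r]. *)
Definition local_dependence (P : prime_ideal B) (F : B) r :=
  forall b : 'I_r.+1 -> B, exists i u (c : 'I_r.+1 -> B) d, u \notin P /\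
    u * b i = \sum_(j < r.+1 | (j < i)%N) c j * b j + F * d.

(* [div(0, F)] is a positive multiple of [P] plus a torsion cycle. *)
Lemma torsion_cycle_div (F : B) (P : prime_of_dim B 1) r :
    F != 0 -> F \in val P -> local_dependence (val P) F r ->
    finite_set [set P' : prime_of_dim B 1 | F \in val P'] ->
    (forall P' : prime_of_dim B 1, F \in val P' -> P' != P -> torsion_cycle << P' >>) ->
  torsion_cycle << P >>.
Proof.
move=> F0 FP depF finF others.
have [e [Me ann_e]] := quot_quot_cyclic Z F.
have annF b d : b = F * d -> b *: e = 0.
  by move=> ->; apply/ann_e; exists d; rewrite subrr rpred0.
have divF : div_cycle 1 Z F \in @rat_equiv B 1.
  apply/asboolP => H; apply => //; apply/negP => /Z0 F0'.
  by rewrite F0' eqxx in F0.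
(* [F] kills the module and is invertible at [P']: this is the dependence with [r = 0]. *)
have len0 (P' : prime_of_dim B 1) : F \notin val P' ->
    length (loc_mod (val P') (quot_quot Z F)) = 0%N.
  move=> FP'; apply/eqP; rewrite -leqn0; apply: (length_loc_le Me) => b.
  exists ord0, F, (fun=> 0); split=> //; apply: (@annF _ (b ord0)).
  by rewrite big_pred0 ?subr0.
have lenP : (0 < length (loc_mod (val P) (quot_quot Z F)))%N.
  apply: (length_loc_gt0 Me (r := r)) => [b|b /ann_e[c /Z0/subr0_eq ->]].
    have [i [u [c [d [uP E]]]]] := depF b; exists i, u, c; split=> //.
    by apply: (@annF _ d); rewrite E addrC addKr.
  by rewrite mulrC idealMr.
(* The support of the indicator function of the primes containing [F] turns this finite set into a
   duplicate-free list. *)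
have [s us sE] : exists2 s : seq (prime_of_dim B 1), uniq s &
    forall P', (P' \in s) = (F \in val P').
  exists (finite_support (0 : int) [set: prime_of_dim B 1] (fun P' => (F \in val P')%:R)).
    exact: finite_support_uniq.
  move=> P'; rewrite in_finite_support.
    rewrite in_setI in_setT /=.
    apply/idP/idP => [/set_mem /=|h]; last apply/mem_set => /=.
      by case: (F \in val P').
    by rewrite h; apply/eqP; rewrite oner_neq0.
  apply: sub_finite_set finF => Q [_ /=]; by case: (F \in val Q).
move: divF; rewrite /div_cycle /cycle_of (@fsbigE _ _ _ _ _ s) //; last first.
  by move=> P' _; rewrite sE => /len0 ->; rewrite freegU0.
under eq_bigl => P' do rewrite in_setT.
rewrite (bigD1_seq P) ?sE //= => divF.
apply: (torsion_cycleMn lenP); rewrite freegU_muln natz.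
set y := <<_ *g _>> in divF *; set z := \sum_(i <- _ | _) _ in divF.
rewrite -[y](addrK z); apply: torsion_cycleB; first by exists 1%N; rewrite ?mulr1n.
apply: torsion_cycle_sum => P'; rewrite sE => FP' P'P.
exact/torsion_cycle_point/others.
Qed.

End TorsionCycles.

(** * Primes containing a coordinate *)

Lemma poly_splitX (E : nzRingType) (t : {poly E}) : exists q, t = q * 'X + (t`_0)%:P.
Proof.
have [|q qE] := @polyXdiv E (t - (t`_0)%:P); first by rewrite coefB coefC subrr.
by exists q; rewrite -qE subrK.
Qed.

Section CoordinatePrime.
Variables (k : closedFieldType) (B : comNzRingType).
Variables (phi : {rmorphism {poly {poly k}} -> B}) (P : prime_ideal B).
Hypotheses (phi_int : forall b, integralOver phi b) (XP : phi 'X \in P).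
Hypothesis dimP : has_krull_dim {ideal_quot P} 1.

Let phiX (t : {poly {poly k}}) : phi t - phi (t`_0)%:P \in P.
Proof.
have [q {1}->] := poly_splitX t.
by rewrite rmorphD addrK rmorphM idealMr.
Qed.

(* If [phi t] were in [P], some [Y - c] would be as well, [c] in [k], so that all of
   [B] would be congruent to constants modulo [P] and [P] would be maximal. *)
Lemma coordinate_prime (t : {poly {poly k}}) : t`_0 != 0 -> phi t \notin P.
Proof.
move=> t0; apply/negP => tP.
have : phi (t`_0)%:P \in P by rewrite -(subKr (phi t) (phi _)) rpredB.
have [rs ts] := closed_field_poly_normal t`_0.
rewrite ts -mul_polyC rmorphM rmorphM prime_idealrM => /orP[cP|].
  suff : 1 \in P by rewrite idealr1.
  have <- : phi (((lead_coef t`_0)^-1)%:P)%:P * phi ((lead_coef t`_0)%:P)%:P = 1.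
    by rewrite -!rmorphM mulVf ?lead_coef_eq0 // !rmorph1.
  exact: idealMr.
rewrite !rmorph_prod => /mem_prime_prod[c _ cP].
(* Modulo [P], a polynomial is its value at [X = 0], [Y = c]. *)
have cst (u : {poly {poly k}}) : phi u - phi ((u`_0).[c])%:P%:P \in P.
  rewrite -(subrK (phi (u`_0)%:P) (phi u)) -addrA; apply: rpredD; first exact: phiX.
  have /factor_theorem[q qE] : root (u`_0 - ((u`_0).[c])%:P) c.
    by rewrite /root hornerD hornerN hornerC subrr.
  by rewrite -!rmorphB qE !rmorphM idealMr.
have allcst b : exists c', b - phi (c'%:P)%:P \in P.
  have [p p1 /rootP pb] := phi_int b.
  pose g : {rmorphism {poly {poly k}} -> k} := horner_eval c \o horner_eval 0.
  have gE u : g u = (u`_0).[c] by rewrite /= /horner_eval horner_coef0.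
  pose h : {rmorphism k -> B} := phi \o polyC \o polyC.
  (* Modulo [P], the integral equation of [b] becomes a monic equation over [k], which splits; the
     prime [P] then contains some [b - c']. *)
  have q1 : map_poly g p \is monic by exact: monic_map.
  have : (map_poly h (map_poly g p)).[b] \in P.
    rewrite -map_poly_comp.
    have -> : (map_poly (h \o g) p).[b] = \sum_(i < size p) h (g p`_i) * b ^+ i.
      rewrite (@horner_coef_wide _ (size p)) ?size_poly //.
      by apply: eq_bigr => i _; rewrite coef_map.
    move: pb; rewrite (@horner_coef_wide _ (size p)) ?size_poly // => pb.
    rewrite -[X in X \in P]subr0 -[X in _ - X]pb -sumrB; apply: rpred_sum => i _.
    rewrite coef_map -mulrBl mulrC idealMr //.
    by rewrite -opprB rpredN -[h _]/(phi (g p`_i)%:P%:P) gE; apply: cst.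
  have [rs' ->] := closed_field_poly_normal (map_poly g p).
  rewrite (monicP q1) scale1r rmorph_prod horner_prod => /mem_prime_prod[c' _].
  by rewrite rmorphB /= map_polyX map_polyC hornerXsubC /=; exists c'.
(* A prime [Q] strictly above [P] contains some [x] congruent modulo [P] to a nonzero constant,
   hence a unit. *)
have [Q /strict_subP[PQ [x xQ xP]]] := dim1_above dimP.
have [c' xc] := allcst x.
have [c'0|c'0] := eqVneq c' 0.
  by move: xc; rewrite c'0 !rmorph0 subr0; apply/negP.
have cQ : phi (c'%:P)%:P \in Q by rewrite -(subKr x (phi _)) rpredB // PQ.
suff : 1 \in Q by rewrite idealr1.
have <- : phi ((c'^-1)%:P)%:P * phi (c'%:P)%:P = 1.
  by rewrite -!rmorphM mulVf // !rmorph1.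
exact: idealMr.
Qed.

End CoordinatePrime.

(** * Primes over a coordinate: local dependence and associated primes *)

Section UniquePrime.
Variables (k : closedFieldType) (B : comNzRingType) (A : idomainType).
Variables (f : {rmorphism B -> A}) (phi : {rmorphism {poly {poly k}} -> B}).
Variables (r : nat) (s : 'I_r -> A).
Hypothesis finj : injective f.
Hypothesis span : forall a, exists c : 'I_r -> {poly {poly k}},
  a = \sum_(j < r) f (phi (c j)) * s j.
Let xi := phi 'X.
Hypothesis xi0 : xi != 0.

Let psi : {rmorphism {poly {poly k}} -> A} := f \o phi.

Let psiX0 : psi 'X != 0.
Proof. by rewrite /= -(rmorph0 f) (inj_eq finj). Qed.

Lemma finite_integral_sub b : integralOver phi b.
Proof.
have [p p1 /rootP pb] := @finite_integral _ _ psi r s span (f b).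
exists p => //; apply/rootP/finj; rewrite rmorph0 -pb.
by rewrite -horner_map -map_poly_comp.
Qed.

Lemma finite_integral_over a : integralOver f a.
Proof.
have [p p1 pb] := @finite_integral _ _ psi r s span a.
exists (map_poly phi p); first exact: monic_map.
by rewrite -map_poly_comp.
Qed.

Section OnePrime.
Variable P : prime_ideal B.
Hypotheses (dimP : has_krull_dim {ideal_quot P} 1) (xiP : xi \in P).

Let tP := coordinate_prime finite_integral_sub xiP dimP.

(** In a relation between the [b j] whose coefficients are not all multiples of ['X], let [i] be the
    last index with a nonzero constant term: [phi (t i)] is outside [P], and the later coefficients
    are multiples of [xi]. *)
Lemma local_dependence_coordinate : local_dependence P xi r.
Proof.
move=> b; have [t [i0 ti0] tb] := finite_dependent_poly (E := {poly k} : idomainType)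
  (phi := psi) (fun i => f (b i)) span psiX0.
case: (arg_maxnP (fun i : 'I_r.+1 => i : nat) (P := fun i => (t i)`_0 != 0) ti0).
move=> i ti maxi.
have /choice[q qE] (j : 'I_r.+1) : exists q, (i < j)%N -> t j = q * 'X.
  have [ij|_] := boolP (i < j)%N; last by exists 0.
  have [|q tq] := @polyXdiv _ (t j); last by exists q.
  by apply/eqP; apply: contraLR ij => /maxi; rewrite -leqNgt.
exists i, (phi (t i)), (fun j => - phi (t j)).
exists (- \sum_(j < r.+1 | (i < j)%N) phi (q j) * b j).
split; first exact: tP.
have {tb} : \sum_j phi (t j) * b j = 0.
  apply: finj; rewrite rmorph0 rmorph_sum -[RHS]tb.
  by apply: eq_bigr => j _; rewrite rmorphM.
rewrite (bigD1 i) //= => /eqP; rewrite addr_eq0 => /eqP ->.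
rewrite (bigID (fun j : 'I_r.+1 => (j < i)%N)) /= opprD mulrN mulr_sumr -!sumrN.
congr (_ + _); apply: eq_big => j; rewrite ?mulNr //.
- by rewrite -(inj_eq val_inj) /=; case: ltngtP.
- by rewrite -(inj_eq val_inj) /=; case: ltngtP.
- move=> /andP[ji]; rewrite -leqNgt leq_eqVlt eq_sym (inj_eq val_inj) (negPf ji) /= => ij.
  by rewrite qE // rmorphM; congr (- _); rewrite mulrAC mulrC mulrCA.
Qed.

Variable Q : prime_ideal A.
Hypothesis QP : comap f Q = P.

Let xiQ : f xi \in Q.
Proof. by rewrite -mem_comap QP. Qed.

Let psiQ (t : {poly {poly k}}) : t`_0 != 0 -> psi t \notin Q.
Proof. by move=> t0; rewrite /= -mem_comap QP tP. Qed.

Local Notation mod0 a := (exists z, a = f xi * z).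

(** In a relation between the powers of [p], let [i] be the least index with a nonzero constant
    term. Modulo [xi], what remains is [p ^+ i] times [psi (t i) + p * S], which is outside [Q]
    since [p] is in [Q]. *)
Lemma coordinate_nilpotent p : p \in Q -> exists n s', s' \notin Q /\ mod0 (s' * p ^+ n).
Proof.
move=> pQ.
have [t [i0 ti0] tb] := finite_dependent_poly (E := {poly k} : idomainType)
  (phi := psi) (fun i : 'I_r.+1 => p ^+ i) span psiX0.
case: (arg_minnP (fun i : 'I_r.+1 => i : nat) (P := fun i => (t i)`_0 != 0) ti0).
move=> i ti mini.
have /choice[q qE] (j : 'I_r.+1) : exists q, (j < i)%N -> t j = q * 'X.
  have [ij|_] := boolP (j < i)%N; last by exists 0.
  have [|q tq] := @polyXdiv _ (t j); last by exists q.
  by apply/eqP; apply: contraLR ij => /mini; rewrite -leqNgt.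
pose S := \sum_(j < r.+1 | (i < j)%N) psi (t j) * p ^+ (j - i.+1).
exists i, (psi (t i) + p * S); split.
  apply: contra (psiQ ti) => h; rewrite -[psi (t i)](addrK (p * S)).
  by rewrite rpredB // mulrC idealMr.
exists (- \sum_(j < r.+1 | (j < i)%N) psi (q j) * p ^+ j).
move: tb; rewrite (bigD1 i) //= (bigID (fun j : 'I_r.+1 => (i < j)%N)) /=.
rewrite addrA => /eqP; rewrite addr_eq0 => /eqP tb.
transitivity (psi (t i) * p ^+ i +
    \sum_(j < r.+1 | (j != i) && (i < j)%N) psi (t j) * p ^+ j).
  rewrite mulrDl; congr (_ + _); rewrite mulr_sumr mulr_suml; apply: eq_big => j.
    by case: eqVneq => [->|] /=; rewrite ?ltnn.
  move=> ij; have -> : p ^+ j = p * p ^+ (j - i.+1) * p ^+ i.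
    by rewrite -exprS -exprD subnSK // subnK // ltnW.
  by ring.
rewrite [LHS]tb mulrN mulr_sumr; congr (- _); apply: eq_big => j.
  by rewrite -leqNgt ltn_neqAle (inj_eq val_inj).
rewrite -leqNgt => /andP[ji ij]; rewrite qE ?ltn_neqAle ?(inj_eq val_inj) ?ji //.
by rewrite !rmorphM /= mulrAC mulrC mulrCA.
Qed.

(* Modulo [xi], the ideals of [A] are submodules of a finite module over the
   principal ideal domain [k[Y]]. *)
Lemma ideal_generated_mod (J : set A) :
    J 0 -> (forall a u v, J u -> J v -> J (a * u + v)) ->
  exists L : seq A, (forall x, x \in L -> J x) /\ forall I : set A,
    I 0 -> (forall a u v, I u -> I v -> I (a * u + v)) -> I (f xi) ->
    (forall x, x \in L -> I x) -> J `<=` I.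
Proof.
move=> J0 JL.
pose rep (c : 'I_r -> {poly k}) a := exists z, a = \sum_i psi (c i)%:P * s i + f xi * z.
(* Induction on [j], for the elements of [J] having coordinates modulo [f xi] that vanish from index
   [j] on. *)
suff H j : (j <= r)%N -> exists L : seq A, (forall x, x \in L -> J x) /\
    forall I : set A,
    I 0 -> (forall a u v, I u -> I v -> I (a * u + v)) -> I (f xi) ->
    (forall x, x \in L -> I x) ->
    forall a c, J a -> rep c a -> (forall i : 'I_r, (j <= i)%N -> c i = 0) -> I a.
  have [L [LJ LI]] := H r (leqnn r).
  exists L; split=> // I I0 IL Ixi IL' a Ja; have [c ac] := span a.
  have /choice[q qE] i := poly_splitX (c i).
  apply: (LI I I0 IL Ixi IL' a (fun i => (c i)`_0)) => //; last first.
    by move=> i; rewrite leqNgt ltn_ord.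
  exists (\sum_i psi (q i) * s i); rewrite ac mulr_sumr -big_split.
  apply: eq_bigr => i _ /=.
  by rewrite {1}qE !(rmorphD, rmorphM) /=; ring.
elim: j => [_|j IH ltjr].
  exists [::]; split=> // I I0 IL Ixi _ a c Ja [z ->] c0.
  rewrite big1 => [|i _]; first by rewrite addrC mulrC; apply: IL.
  by rewrite c0 // rmorph0 mul0r.
have [L [LJ LI]] := IH (ltnW ltjr); pose i0 := Ordinal ltjr.
(* The nonzero coordinates at index [j]. One of least size, [g], divides all of them, since a
   nonzero remainder would again be in [D]; so the element [a0] behind [g] is the only new
   generator. *)
pose D := [set g | exists a c, [/\ J a, rep c a,
   (forall i : 'I_r, (j < i)%N -> c i = 0), c i0 = g & g != 0]].
have c0j (c : 'I_r -> {poly k}) : (forall i : 'I_r, (j < i)%N -> c i = 0) -> c i0 = 0 ->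
    forall i : 'I_r, (j <= i)%N -> c i = 0.
  move=> c1 c0 i; rewrite leq_eqVlt => /orP[/eqP ji|/c1 //].
  by rewrite -[RHS]c0; congr c; apply: val_inj.
have [D0|nD] := pselect (exists g, D g); last first.
  exists L; split=> // I I0 IL Ixi IL' a c Ja ra c1.
  apply: (LI I I0 IL Ixi IL' a c) => //; apply: c0j => //.
  by apply/eqP; apply: contrapT => /negP ci0; apply: nD; exists (c i0), a, c.
have [g [a0 [c0 [Ja0 [z0 ra0] c01 c0g g0]]] gmin] : exists2 g, D g &
    forall g', D g' -> (size g <= size g')%N.
  case: D0 => g0; have [n] := ubnP (size g0); elim: n g0 => // n IHn g0 ltn Dg0.
  have [[g' [Dg' ltg']]|nex] := pselect (exists g', D g' /\ (size g' < size g0)%N).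
    by apply: (IHn g') => //; apply: leq_trans ltg' _; rewrite -ltnS.
  exists g0 => // g' Dg'; rewrite leqNgt; apply/negP => ltg'.
  by apply: nex; exists g'.
exists (a0 :: L); split=> [x|I I0 IL Ixi IL' a c Ja [z ra] c1].
  by rewrite inE => /predU1P[->|/LJ].
have Ia0 : I a0 by apply: IL'; rewrite mem_head.
pose h := c i0 %/ g; pose d i := c i - h * c0 i.
rewrite -(subrK (psi h%:P * a0) a) addrC; apply: (IL) => //.
have Jd : J (a - psi h%:P * a0) by rewrite addrC -mulNr; apply: JL.
have rd : rep d (a - psi h%:P * a0).
  exists (z - psi h%:P * z0); rewrite ra ra0 mulrDr opprD addrACA mulrBr.
  congr (_ + _); last by congr (_ - _); ring.
  rewrite mulr_sumr -sumrB; apply: eq_bigr => i _.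
  by rewrite /d !rmorphB !rmorphM /=; ring.
have d1 (i : 'I_r) : (j < i)%N -> d i = 0.
  by move=> ji; rewrite /d c1 // c01 // mulr0 subrr.
have dr : d i0 = c i0 %% g.
  by rewrite /d c0g {1}(divp_eq (c i0) g) addrC addKr.
apply: (LI I I0 IL Ixi _ _ d) => //.
  by move=> x xL; apply: IL'; rewrite inE xL orbT.
apply: c0j => //; apply/eqP; apply: contrapT => /negP di0.
have : (size g <= size (d i0))%N by apply: gmin; exists (a - psi h%:P * a0), d.
by rewrite dr leqNgt ltn_modp g0.
Qed.

(** Starting from 1, [v] is multiplied, for each generator [p] of [Q] modulo [xi], by the highest
    power of [p] that does not kill it locally at [Q]; local nilpotence bounds this power. Some [s']
    outside [Q] then kills all [p * v], and the annihilator of [s' * v] modulo [xi] is exactly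
    [Q]. *)
Lemma coordinate_assoc : is_assoc_prime (quot_mod (multiples A^o (f xi))) Q.
Proof.
suff [v vQ] : exists v, forall a, a \in Q <-> mod0 (a * v).
  exists (to_quot_mod _ (v : A^o)) => a; rewrite vQ scale_to_quot_mod to_quot_mod_eq0.
  by split=> [[z az]|/asboolP[z az]]; [apply/asboolP|]; exists z.
have [||L [LQ LI]] := @ideal_generated_mod [set x | x \in Q].
- exact: rpred0.
- by move=> a u v /= uQ vQ; rewrite rpredD ?idealMr.
have [v [vQ [s' [s'Q s'L]]]] : exists v, (forall a, mod0 (a * v) -> a \in Q) /\
    exists s', s' \notin Q /\ forall p, p \in L -> mod0 (s' * p * v).
  elim: (L) LQ => [_|p L' IH LQ].
    exists 1; split=> [a [z]|]; first by rewrite mulr1 => ->; rewrite mulrC idealMr.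
    by exists 1; rewrite idealr1.
  have [v [vQ [s1 [s1Q s1L]]]] := IH (fun x xL => LQ x (mem_behead (s := p :: L') xL)).
  have /coordinate_nilpotent[n [s2 [s2Q s2n]]] : p \in Q by apply: LQ; rewrite mem_head.
  (* [p ^+ i * v] vanishes modulo [xi] after localization at [Q]. *)
  pose killed i := `[< exists s3, s3 \notin Q /\ mod0 (s3 * p ^+ i * v) >].
  have ex_killed : exists i, killed i.
    exists n; apply/asboolP; exists s2; split=> //.
    by have [z ->] := s2n; exists (z * v); rewrite mulrA.
  case: (ex_minnP ex_killed) => -[|i] /asboolP[s3 [s3Q s3v]] mini.
    by case/negP: s3Q; apply: vQ; rewrite -[s3]mulr1 -(expr0 p).
  exists (p ^+ i * v); split=> [a av|].
    apply: contrapT => /negP aQ.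
    have : killed i by apply/asboolP; exists a; rewrite -mulrA.
    by move/mini; rewrite ltnn.
  exists (s1 * s3); split; first by rewrite prime_idealrM negb_or s1Q.
  move=> x; rewrite inE => /predU1P[->|/s1L[z s1x]].
    have [z s3z] := s3v; exists (s1 * z).
    by rewrite [RHS]mulrCA -s3z exprS; ring.
  by exists (s3 * p ^+ i * z); rewrite [RHS]mulrCA -s1x; ring.
exists (s' * v) => a; split=> [aQ|]; last first.
  by rewrite mulrA => /vQ; rewrite prime_idealrM (negPf s'Q) orbF.
(* The annihilator of [s' * v] modulo [f xi] is an ideal containing [f xi] and all of [L]. *)
apply: (LI [set a | mod0 (a * (s' * v))]) => //=.
- by exists 0; rewrite mul0r mulr0.
- move=> a1 u w [z1 uz] [z2 wz]; exists (a1 * z1 + z2).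
  by rewrite mulrDl -mulrA uz wz; ring.
- by exists (s' * v).
- by move=> p /s'L[z pz]; exists z; rewrite -pz; ring.
Qed.

End OnePrime.
End UniquePrime.

(** * Graded rings *)

Section Graded.
Variables (B : comNzRingType) (gr : nat -> set B).
Hypothesis hB : is_grading gr.

Lemma grN n a : gr n a -> gr n (- a).
Proof. by move=> ga; rewrite -sub0r; apply: grading_B => //; apply: grading_0. Qed.

Lemma grD n a b : gr n a -> gr n b -> gr n (a + b).
Proof. by move=> ga gb; rewrite -[b]opprK; apply: grading_B => //; apply: grN. Qed.

Lemma gr_sum n (I : Type) (s : seq I) (Q : pred I) (F : I -> B) :
  (forall i, Q i -> gr n (F i)) -> gr n (\sum_(i <- s | Q i) F i).
Proof. by move=> gF; apply: big_ind => //; [apply: grading_0|apply: grD]. Qed.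

(* An element [a] of [B] is encoded by the polynomial [\sum_n a_n T^n], [a_n] being its
   component of degree [n]; [d] is a shift of the degrees. *)
Definition graded_poly d (p : {poly B}) := forall n, gr (d + n) p`_n.

(** For [d = 0] this is the uniqueness of homogeneous components; multiplying by ['X^d] removes the
    shift. *)
Lemma graded_poly_inj d p : graded_poly d p -> p.[1] = 0 -> p = 0.
Proof.
have inj0 (q : {poly B}) : graded_poly 0 q -> q.[1] = 0 -> q = 0.
  move=> gq q1; apply/polyP => i; rewrite coef0.
  have [iq|/(nth_default 0) //] := ltnP i (size q).
  apply: (@grading_direct _ _ hB (size q) (fun i => q`_i) _ _ (Ordinal iq)).
    by move=> n; apply: gq.
  by rewrite -[RHS]q1 horner_coef; apply: eq_bigr => j _; rewrite expr1n mulr1.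
move=> gp p1; have pX0 : p * 'X^d = 0.
  apply: inj0; last by rewrite hornerM p1 mul0r.
  move=> n; rewrite coefMXn add0n; case: ltnP => [_|dn]; first exact: grading_0.
  by rewrite -{1}(subnKC dn); apply: gp.
apply/polyP => i; have /(congr1 (fun q : {poly B} => q`_(i + d))) := pX0.
by rewrite coefMXn addnK ltnNge leq_addl !coef0.
Qed.

Lemma graded_poly_exists a : exists2 p, graded_poly 0 p & p.[1] = a.
Proof.
have [N [c [gc ->]]] := grading_span hB a.
pose c' i := if insub i is Some j then c j else 0.
have c'E (i : 'I_N) : c' i = c i by rewrite /c' valK.
exists (\poly_(i < N) c' i) => [n|].
  rewrite coef_poly; case: ltnP => [nN|_]; last exact: grading_0.
  by rewrite -[n]/(val (Ordinal nN)) c'E; apply: gc.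
by rewrite horner_poly; apply: eq_bigr => i _; rewrite expr1n mulr1 c'E.
Qed.

Lemma graded_polyB d p q : graded_poly d p -> graded_poly d q -> graded_poly d (p - q).
Proof. by move=> gp gq n; rewrite coefB; apply: grading_B. Qed.

Lemma graded_poly_sum d (I : Type) (s : seq I) (Q : pred I) (F : I -> {poly B}) :
  (forall i, Q i -> graded_poly d (F i)) -> graded_poly d (\sum_(i <- s | Q i) F i).
Proof. by move=> gF n; rewrite coef_sum; apply: gr_sum => i Qi; apply: gF. Qed.

Lemma graded_polyM d e p q :
  graded_poly d p -> graded_poly e q -> graded_poly (d + e) (p * q).
Proof.
move=> gp gq n; rewrite coefM; apply: gr_sum => i _.
have -> : (d + e + n = (d + i) + (e + (n - i)))%N.
  by rewrite addnACA subnKC // -ltnS.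
exact: grading_M.
Qed.

Lemma graded_polyC d a : gr d a -> graded_poly d a%:P.
Proof.
by move=> ga [|n]; rewrite coefC /=; [rewrite addn0|exact: grading_0].
Qed.

Lemma graded_polyMXn d e p : graded_poly (d + e) p -> graded_poly d (p * 'X^e).
Proof.
move=> gp n; rewrite coefMXn; case: ltnP => [_|en]; first exact: grading_0.
by rewrite -{1}(subnKC en) addnA; apply: gp.
Qed.

Section NoHomogeneous.
Variables (P : prime_ideal B) (a : B).
Hypotheses (noh : forall d h, gr d h -> h \in P -> h = 0) (aP : a \in P) (a0 : a != 0).

(* [f] has the smallest spread of degrees among the nonzero elements of [P] and [l] is
   its component of highest degree; the claim is the division algorithm by [f]. *)
Lemma homogeneously_principal : exists f l d,
  [/\ f \in P, f != 0, gr d l, l \notin P &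
    forall g, g \in P -> exists n z, l ^+ n * g = f * z].
Proof.
(* As the shift [d] is free, the least size of a [good] polynomial is the least spread of degrees
   plus one. *)
pose good (p : {poly B}) := p != 0 /\ p.[1] \in P /\ exists d, graded_poly d p.
have [p0 good0] : exists p, good p.
  have [p gp pa] := graded_poly_exists a.
  exists p; split; last by rewrite pa; split=> //; exists 0%N.
  by apply: contra_neq a0 => p0; rewrite -pa p0 horner0.
have [f [f0 [fP [d gf]]] fmin] : exists2 f, good f &
    forall g, good g -> (size f <= size g)%N.
  have [n] := ubnP (size p0); elim: n p0 good0 => // n IHn p goodp ltn.
  have [[q [goodq ltq]]|nex] := pselect (exists q, good q /\ (size q < size p)%N).
    by apply: (IHn q) => //; apply: leq_trans ltq _; rewrite -ltnS.
  exists p => // q goodq; rewrite leqNgt; apply/negP => ltq.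
  by apply: nex; exists q.
pose b := (size f).-1; pose l := lead_coef f.
have gl : gr (d + b) l by apply: gf.
have f1 : f.[1] != 0 by apply: contra_neq f0; apply: graded_poly_inj gf.
exists f.[1], l, (d + b)%N; split=> //.
  by apply/negP => /(noh gl)/eqP; rewrite lead_coef_eq0 (negPf f0).
have div n : forall g e, graded_poly e g -> g.[1] \in P -> (size g < n)%N ->
    exists n' z, l ^+ n' * g.[1] = f.[1] * z.
  elim: n => // n IH g e gg gP ltgn.
  have [->|g0] := eqVneq g 0; first by exists 0%N, 0; rewrite horner0 !mulr0.
  have szf : (size f <= size g)%N by apply: fmin; split=> //; split=> //; exists e.
  have sf0 : (0 < size f)%N by rewrite size_poly_gt0.
  have sg0 : (0 < size g)%N by rewrite size_poly_gt0.
  pose c := (size g).-1; have gc : gr (e + c) (lead_coef g) by apply: gg.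
  have bc : (b <= c)%N by rewrite /b /c -ltnS !prednK.
  (* Pseudo-division: both products are graded with shift [d + b + e], and their top coefficients
     cancel. *)
  pose g' := l%:P * g - (lead_coef g)%:P * f * 'X^(c - b).
  have [|||n' [z zE]] := IH g' (d + b + e)%N.
  - apply: graded_polyB; first by apply: graded_polyM => //; apply: graded_polyC.
    apply: graded_polyMXn; have -> : (d + b + e + (c - b) = (e + c) + d)%N.
      by rewrite -(subnK bc); lia.
    by apply: graded_polyM => //; apply: graded_polyC.
  - by rewrite !(hornerE, expr1n) rpredB // idealMr.
  - apply: (@leq_ltn_trans c); last by rewrite /c -ltnS prednK.
    apply/leq_sizeP => j cj; rewrite coefB coefCM coefMXn coefCM.
    rewrite ltnNge (leq_trans (leq_subr _ _) cj) /=.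
    have [->|jc] := eqVneq j c.
      by rewrite subKn // -!lead_coefE mulrC subrr.
    rewrite [g`_j]nth_default ?[f`_(_)]nth_default ?mulr0 ?subrr //.
      by rewrite -(prednK sf0) -/b; lia.
    by rewrite -(prednK sg0) -/c ltn_neqAle eq_sym jc.
  move: zE; rewrite !(hornerE, expr1n) mulrBr => /eqP; rewrite subr_eq => /eqP zE.
  exists n'.+1, (z + l ^+ n' * lead_coef g); rewrite exprSr -mulrA zE; ring.
move=> g gP; have [p gp pg] := graded_poly_exists g; rewrite -pg.
by apply: (div (size p).+1 p 0%N) => //; rewrite pg.
Qed.

End NoHomogeneous.
End Graded.

(** * Forms *)

Section CoordMap.
Variables (k : comNzRingType) (C : comNzRingType) (kappa : {rmorphism k -> C}) (xi Y : C).

Definition coord_map : {rmorphism {poly {poly k}} -> C} :=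
  horner_morph (fun a => mulrC xi (horner_morph (fun c => mulrC Y (kappa c)) a)).

Lemma coord_mapX : coord_map 'X = xi.
Proof. exact: horner_morphX. Qed.

Lemma coord_mapY : coord_map 'X%:P = Y.
Proof. by rewrite /coord_map /= horner_morphC /= horner_morphX. Qed.

Lemma coord_mapC c : coord_map c%:P%:P = kappa c.
Proof. by rewrite /coord_map /= horner_morphC /= horner_morphC. Qed.

Lemma coord_map_ind (S : set C) :
    (forall c, S (kappa c)) -> (forall u v, S u -> S v -> S (u + v)) ->
    (forall u, S u -> S (u * xi)) -> (forall u, S u -> S (u * Y)) ->
  forall t, S (coord_map t).
Proof.
move=> Sk SD Sxi SY; elim/poly_ind => [|t u St].
  by rewrite rmorph0 -(rmorph0 kappa).
rewrite rmorphD rmorphM coord_mapX; apply: (SD); first exact: Sxi.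
elim/poly_ind: u => [|u c Su]; first by rewrite !rmorph0 -(rmorph0 kappa).
by rewrite !(rmorphD, rmorphM) coord_mapY coord_mapC; apply: SD; first exact: SY.
Qed.

Lemma rmorph_coord_map (C' : comNzRingType) (f : {rmorphism C -> C'})
    (g : {rmorphism {poly {poly k}} -> C'}) :
    (forall c, f (kappa c) = g c%:P%:P) -> f xi = g 'X -> f Y = g 'X%:P ->
  forall t, f (coord_map t) = g t.
Proof.
move=> fc fxi fY; elim/poly_ind => [|t u St]; first by rewrite !rmorph0.
rewrite !(rmorphD, rmorphM) coord_mapX fxi St; congr (_ + _).
elim/poly_ind: u => [|u c Su]; first by rewrite !rmorph0.
by rewrite !(rmorphD, rmorphM) coord_mapY coord_mapC fc fY Su.
Qed.

End CoordMap.

Section Forms.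
Variables (k : closedFieldType) (B : comNzRingType) (kappa : {rmorphism k -> B}).
Variables (x0 x1 : B).

(** For [u] of degree at most [e], its homogenization of degree [e] evaluated at [(x0, x1)]. *)
Definition form e (u : {poly k}) := \sum_(i < e.+1) kappa u`_i * x0 ^+ i * x1 ^+ (e - i).

Lemma formD e u v : form e (u + v) = form e u + form e v.
Proof.
by rewrite -big_split; apply: eq_bigr => i _ /=; rewrite coefD rmorphD; ring.
Qed.

Lemma formZ e c u : form e (c *: u) = kappa c * form e u.
Proof.
by rewrite mulr_sumr; apply: eq_bigr => i _; rewrite coefZ rmorphM; ring.
Qed.

Lemma formX e u : form e.+1 (u * 'X) = form e u * x0.
Proof.
rewrite /form big_ord_recl coefMX /= rmorph0 !mul0r add0r mulr_suml.
apply: eq_bigr => i _; rewrite coefMX /bump /= add1n subSS exprS; ring.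
Qed.

Lemma formS e (u : {poly k}) : (size u <= e.+1)%N -> form e.+1 u = form e u * x1.
Proof.
move=> ue; rewrite /form big_ord_recr /= (nth_default _ ue) rmorph0 !mul0r addr0.
rewrite mulr_suml; apply: eq_bigr => i _.
by rewrite subSn -1?ltnS // exprSr mulrA.
Qed.

(** Each root [z] gives the factor [x0 - kappa z * x1], and the defect of the degree below [e] gives
    factors [x1]. *)
Lemma form_prod e c rs : (size rs <= e)%N ->
  form e (c *: \prod_(z <- rs) ('X - z%:P)) =
    kappa c * \prod_(xi <- nseq (e - size rs) x1 ++ [seq x0 - kappa z * x1 | z <- rs]) xi.
Proof.
rewrite formZ => le_e; congr (_ * _).
elim: rs e le_e => [|z rs IH] e /= le_e.
  rewrite big_nil subn0 cats0 big_nseq -Monoid.iteropE /= /form big_ord_recl.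
  rewrite big1 ?addr0 => [|i _]; last by rewrite coef1 rmorph0 !mul0r.
  by rewrite coef1 rmorph1 subn0 mulr1 mul1r.
case: e le_e => // e le_e; rewrite big_cons mulrC mulrBr formD formX.
rewrite [_ * z%:P]mulrC mul_polyC -scaleNr formZ rmorphN formS ?size_prod_XsubC // IH //.
by rewrite !big_cat /= big_cons subSS; ring.
Qed.

Variable m : nat.
Hypothesis m0 : (0 < m)%N.

(** Zero is a form of every degree [n]: the components of degree not divisible by [m] vanish. *)
Definition is_form n a := a = 0 \/
  exists e (u : {poly k}), [/\ n = (m * e)%N, (size u <= e.+1)%N & a = form e u].

(* The coefficient of [T^n] is the component of degree [n] of the value at [T = 1]. *)
Definition coord_map_graded : {rmorphism {poly {poly k}} -> {poly B}} :=
  coord_map (polyC \o kappa) (x0%:P * 'X^m) (x1%:P * 'X^m).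

Lemma coord_map_gradedE t : (coord_map_graded t).[1] = coord_map kappa x0 x1 t.
Proof.
apply: (rmorph_coord_map (f := horner_eval 1) (g := coord_map kappa x0 x1)) => [c||].
- by rewrite coord_mapC /= /horner_eval hornerC.
- by rewrite coord_mapX /= /horner_eval !(hornerE, expr1n).
- by rewrite coord_mapY /= /horner_eval !(hornerE, expr1n).
Qed.

Lemma coord_map_graded_form t n : is_form n (coord_map_graded t)`_n.
Proof.
have mulMX (x : B) (p : {poly B}) :
    (forall n a, is_form n a -> is_form (n + m) (a * x)) ->
    (forall n, is_form n p`_n) -> forall n, is_form n (p * (x%:P * 'X^m))`_n.
  move=> fx fp i; rewrite mulrA coefMXn; case: ltnP => [_|mi]; first by left.
  by rewrite coefMC -{1}(subnK mi); apply: fx.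
move: n; change ([set p : {poly B} | forall n, is_form n p`_n] (coord_map_graded t)).
apply: coord_map_ind => /= [c n|p q fp fq n|p|p].
- rewrite /= coefC; case: eqP => [->|_]; last by left.
  right; exists 0%N, c%:P; rewrite muln0 (leq_trans (size_polyC_leq1 _)) //; split=> //.
  by rewrite /form big_ord1 coefC !mulr1.
- rewrite coefD; case: (fp n) => [->|[e [u [ne ue ->]]]]; first by rewrite add0r.
  case: (fq n) => [->|[e' [v [ne' ve ->]]]]; first by rewrite addr0; right; exists e, u.
  have ee' : e = e' by apply/eqP; rewrite -(eqn_pmul2l m0) -ne -ne'.
  right; exists e, (u + v); rewrite formD -ee' in ve *; split=> //.
  by apply: leq_trans (size_polyD _ _) _; rewrite geq_max ue.
- apply: mulMX => {}n a [->|[e [u [-> ue ->]]]]; first by left; rewrite mul0r.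
  right; exists e.+1, (u * 'X); rewrite formX mulnSr; split=> //.
  by apply: leq_trans (size_polyMleq _ _) _; rewrite size_polyX addn2.
- apply: mulMX => {}n a [->|[e [u [-> ue ->]]]]; first by left; rewrite mul0r.
  by right; exists e.+1, u; rewrite formS // mulnSr; split=> //; apply: leqW.
Qed.

Variable gr : nat -> set B.
Hypotheses (hB : is_grading gr) (kappa0 : forall c, gr 0%N (kappa c)).
Hypotheses (gx0 : gr m x0) (gx1 : gr m x1).
Hypothesis domB : forall a b : B, a * b = 0 -> a = 0 \/ b = 0.
Hypothesis B_int : forall b, integralOver (coord_map kappa x0 x1) b.

Lemma graded_coord_map_graded t : graded_poly gr 0 (coord_map_graded t).
Proof.
have gMX (x : B) (p : {poly B}) : gr m x -> graded_poly gr 0 p ->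
    graded_poly gr 0 (p * (x%:P * 'X^m)).
  move=> gx gp; rewrite mulrA; apply: graded_polyMXn => //.
  by apply: (@graded_polyM _ _ _ 0%N m) => //; apply: graded_polyC.
apply: coord_map_ind => [c|p q gp gq|p|p]; try exact: gMX.
- exact: graded_polyC.
- by move=> n; rewrite coefD; apply: grD.
Qed.

(* A nonzero homogeneous element divides a nonzero form: a coefficient in the component
   of top degree of an equation of integral dependence. *)
Lemma homogeneous_dvd_form d h : gr d h -> h != 0 ->
  exists n w z, [/\ is_form n w, w != 0 & w = h * z].
Proof.
move=> gh h0; have [n [c hn]] := integral_eqn (B_int h).
(* [H] encodes [h], of degree [d], and [Q] encodes its integral equation; [Q] is zero because its
   value at 1 is. *)
pose H := h%:P * 'X^d; pose Q := H ^+ n - \sum_(i < n) coord_map_graded (c i) * H ^+ i.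
have gHX i : graded_poly gr 0 (H ^+ i).
  elim: i => [|i IH]; first by rewrite expr0; apply: graded_polyC => //; apply: grading_1.
  rewrite exprS; apply: (@graded_polyM _ _ _ 0%N 0%N) => //.
  by apply: graded_polyMXn => //; apply: graded_polyC.
have Q0 : Q = 0.
  apply: (graded_poly_inj hB (d := 0%N)).
    apply: graded_polyB => //; apply: graded_poly_sum => // i _.
    by apply: (@graded_polyM _ _ _ 0%N 0%N) => //; apply: graded_coord_map_graded.
  rewrite hornerD hornerN horner_exp hornerM hornerC hornerXn expr1n mulr1 hn.
  rewrite horner_sum; apply/eqP; rewrite subr_eq0; apply/eqP/eq_bigr => i _.
  by rewrite hornerM coord_map_gradedE horner_exp hornerM hornerC hornerXn expr1n mulr1.
have HE i : H ^+ i = (h ^+ i)%:P * 'X^(d * i) by rewrite exprMn -rmorphXn exprM.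
(* The component of degree [d * n] of the equation. *)
have {}hn : h ^+ n = \sum_(i < n) (coord_map_graded (c i))`_(d * n - d * i) * h ^+ i.
  have /(congr1 (fun q : {poly B} => q`_(d * n))) := Q0.
  rewrite coef0 coefB HE coefMXn ltnn subnn coefC eqxx coef_sum => /eqP.
  rewrite subr_eq0 => /eqP ->; apply: eq_bigr => i _.
  by rewrite HE mulrA coefMXn ltnNge leq_mul2l ltnW ?orbT //= coefMC.
pose w i := (coord_map_graded (c i))`_(d * n - d * i).
have fw i : exists n', is_form n' (w i).
  by exists (d * n - d * i)%N; apply: coord_map_graded_form.
have {}hn : h ^+ n = \sum_(i < n) w i * h ^+ i by [].
(* If the constant term [w 0] vanishes, the equation is divided by [h]; otherwise [w 0] is the
   nonzero form sought, a multiple of [h]. *)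
clearbody w; elim: n {c Q Q0} w fw hn => [|n IH] w fw.
  by rewrite big_ord0 expr0 => /eqP; rewrite oner_eq0.
rewrite big_ord_recl expr0 mulr1 exprS.
have -> : \sum_(i < n) w (fintype.lift ord0 i) * h ^+ fintype.lift ord0 i =
    h * \sum_(i < n) w i.+1 * h ^+ i.
  rewrite mulr_sumr; apply: eq_bigr => i _.
  by rewrite /= /bump /= add1n exprS; ring.
have [->|w0] := eqVneq (w 0%N) 0; last first.
  move=> hn; have [n' fw0] := fw 0%N.
  exists n', (w 0%N), (h ^+ n - \sum_(i < n) w i.+1 * h ^+ i); split=> //.
  by rewrite mulrBr hn addrK.
rewrite add0r => /eqP; rewrite -subr_eq0 -mulrBr => /eqP /domB[hz|/subr0_eq hn].
  by rewrite hz eqxx in h0.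
exact: (IH (fun i => w i.+1)).
Qed.

(** A nonzero form divisible by [h] splits into linear factors, up to a unit. The list [L] serves
    all primes at once, which later bounds the set of primes containing [h]. *)
Lemma homogeneous_linear_factor d h : gr d h -> h != 0 ->
  exists L : seq B, (forall xi, xi \in L ->
      xi != 0 /\ (xi = x1 \/ exists c, xi = x0 - kappa c * x1)) /\
    forall P : prime_ideal B, h \in P -> exists2 xi, xi \in L & xi \in P.
Proof.
move=> gh h0.
have [n [w [z [[w0|[e [u [_ ue wE]]]] w0' wz]]]] := homogeneous_dvd_form gh h0.
  by rewrite w0 eqxx in w0'.
rewrite wE in w0' wz => {wE}.
have u0 : u != 0.
  apply: contra_neq w0' => ->; rewrite /form big1 // => i _.
  by rewrite coef0 rmorph0 !mul0r.
have [rs uE] := closed_field_poly_normal u.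
have lt_rs : (size rs <= e)%N.
  by move: ue; rewrite uE size_scale ?lead_coef_eq0 // size_prod_XsubC.
rewrite uE form_prod // in w0' wz.
set L := _ ++ _ in w0' wz; exists L; split=> [xi xiL|P hP].
  split; last first.
    move: xiL; rewrite mem_cat mem_nseq.
    move=> /orP[/andP[_ /eqP ->]|/mapP[c _ ->]]; first by left.
    by right; exists c.
  apply: contra_neq w0' => xi0; rewrite (big_rem _ xiL) /= xi0; ring.
have : kappa (lead_coef u) * \prod_(xi <- L) xi \in P by rewrite wz mulrC idealMr.
rewrite prime_idealrM => /orP[cP|]; last exact: mem_prime_prod.
suff : 1 \in P by rewrite idealr1.
have <- : kappa (lead_coef u)^-1 * kappa (lead_coef u) = 1.
  by rewrite -rmorphM mulVf ?lead_coef_eq0 // rmorph1.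
exact: idealMr.
Qed.

End Forms.

(** * Polynomial subrings and lifted morphisms *)

Section PolySubring.
Import (canonicals) mpoly.
Variables (k : fieldType) (A : comNzRingType) (iota : {rmorphism k -> A}).
Variables (r : nat) (X : 'I_r -> A).

Lemma poly_subring_cst c : poly_subring iota X (iota c).
Proof. by exists (mpoly.mpolyC r c) => //; rewrite mpoly.mmapC. Qed.

Lemma poly_subring_var j : poly_subring iota X (X j).
Proof.
by exists (mpoly.mpolyX _ (mpoly.mnm1 j)) => //; rewrite mpoly.mmapX mpoly.mmap1U.
Qed.

Lemma poly_subringD u v :
  poly_subring iota X u -> poly_subring iota X v -> poly_subring iota X (u + v).
Proof. by move=> [p _ <-] [q _ <-]; exists (p + q) => //; rewrite rmorphD. Qed.

Lemma poly_subringM u v :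
  poly_subring iota X u -> poly_subring iota X v -> poly_subring iota X (u * v).
Proof. by move=> [p _ <-] [q _ <-]; exists (p * q) => //; rewrite rmorphM. Qed.

Lemma poly_subring_sub (S : set A) :
    (forall c, S (iota c)) -> (forall j, S (X j)) ->
    (forall u v, S u -> S v -> S (u + v)) -> (forall u v, S u -> S v -> S (u * v)) ->
  poly_subring iota X `<=` S.
Proof.
move=> Sk SX SD SM _ [p _ <-].
have S0 : S 0 by rewrite -(rmorph0 iota).
have S1 : S 1 by rewrite -(rmorph1 iota).
apply: (big_ind S S0 SD) => mon _; apply: (SM) => //.
apply: (big_ind S S1 SM) => j _; set n := (n in _ ^+ n).
by elim: n => [|n IH]; rewrite ?expr0 // exprS; apply: SM.
Qed.

(** Excludes [m = 0], since the component of degree 0 consists of constants. *)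
Lemma algebraically_independent_neq j c :
  algebraically_independent iota X -> X j <> iota c.
Proof.
move=> algind Xc.
have /(congr1 (mpoly.mcoeff (mpoly.mnm1 j))) :
    mpoly.mpolyC r c = mpoly.mpolyX _ (mpoly.mnm1 j).
  by apply: algind; rewrite mpoly.mmapC mpoly.mmapX mpoly.mmap1U.
rewrite mpoly.mcoeffC mpoly.mnm1_eq0 mulr0 mpoly.mcoeffX eqxx => /esym/eqP.
by rewrite oner_eq0.
Qed.

End PolySubring.

(** Makes [R] a [k]-algebra: chosen preimages of the constants of [A] form a morphism because the
    inclusion is injective. *)
Lemma lift_rmorphism (K B C : nzRingType) (g : {rmorphism B -> C})
    (h : {rmorphism K -> C}) (f : K -> B) : injective g -> (forall c, g (f c) = h c) ->
  exists f' : {rmorphism K -> B}, f' =1 f.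
Proof.
move=> ginj gf.
have fB : zmod_morphism f by move=> u v; apply: ginj; rewrite rmorphB !gf rmorphB.
have fM : monoid_morphism f.
  by split=> [|u v]; apply: ginj; rewrite ?rmorphM !gf ?rmorph1 ?rmorphM.
pose f1 := GRing.isZmodMorphism.Build K B f fB.
pose f2 := GRing.isMonoidMorphism.Build K B f fM.
by pose f' : {rmorphism K -> B} := HB.pack f f1 f2; exists f'.
Qed.

(** * Torsion classes: primes over linear forms, then all primes of dimension 1 *)

Theorem theorem1p2 (k : closedFieldType)
    (* the graded domain A, with A_0 = k *)
    (A : idomainType) (grA : nat -> set A) (iota : {rmorphism k -> A})
    (hA : is_grading grA) (hk : range iota = grA 0%N)
    (hfg : finitely_generated_algebra iota)
    (hdim : has_krull_dim A 2)
    (* the Noether normalization T = k[X_0, X_1], deg X_0 = deg X_1 = m *)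
    (m : nat) (X : 'I_2 -> A)
    (hT : equidegree_noether_normalization grA iota m X)
    (hAss : forall xi : A, poly_subring iota X xi -> grA m xi -> xi != 0 ->
       (Ass 1 (quot_mod (multiples A^o xi)) #= `I_1)%card)
    (* the graded ring R, with inclusions T -> R -> A of graded rings *)
    (R : comNzRingType) (grR : nat -> set R) (hR : is_grading grR)
    (incl : {rmorphism R -> A}) (incl_inj : injective incl)
    (hRA : forall n, incl @` grR n `<=` grA n)
    (hTR : forall n, poly_subring iota X `&` grA n `<=` incl @` grR n) :
  is_torsion (chow_group R 1).
Proof.
case: hT => gX algind [r [s span]].
have m0 : (0 < m)%N.
  rewrite lt0n; apply/eqP => m0; have := gX ord0; rewrite m0 -hk => -[c _ /esym].
  exact: algebraically_independent_neq.
have gk c : grA 0%N (iota c) by rewrite -hk; exists c.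
have /choice[kappa0 kappa0P] c : exists b, incl b = iota c /\ grR 0%N b.
  by have [b gb bc] := hTR 0%N (iota c) (conj (poly_subring_cst _ _ c) (gk c)); exists b.
have [kappa kappaE] := lift_rmorphism incl_inj (fun c => (kappa0P c).1).
have inclk c : incl (kappa c) = iota c by rewrite kappaE (kappa0P c).1.
have gkappa c : grR 0%N (kappa c) by rewrite kappaE; apply: (kappa0P c).2.
have /choice[x xP] j : exists b, incl b = X j /\ grR m b.
  by have [b gb bX] := hTR m (X j) (conj (poly_subring_var _ _ j) (gX j)); exists b.
pose x0 := x ord0; pose x1 := x ord_max.
have inclx j : incl (x j) = X j by apply: (xP j).1.
have gx j : grR m (x j) by apply: (xP j).2.
have domR (a b : R) : a * b = 0 -> a = 0 \/ b = 0.
  move=> /(congr1 incl)/eqP; rewrite rmorphM rmorph0 mulf_eq0 -!(rmorph0 incl).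
  by rewrite !(inj_eq incl_inj) => /orP[]/eqP; auto.
(* If both [x0] and [x1] are polynomials in [xi] and [Y], then [A] is finite over the image of
   [coord_map kappa xi Y]. *)
have spanR xi Y : (exists t0, coord_map kappa xi Y t0 = x0) ->
    (exists t1, coord_map kappa xi Y t1 = x1) ->
    forall a, exists c : 'I_r -> {poly {poly k}},
      a = \sum_(j < r) incl (coord_map kappa xi Y (c j)) * s j.
  move=> [t0 tx0] [t1 tx1] a; have [c cT ->] := span a.
  pose f : {rmorphism {poly {poly k}} -> A} := incl \o coord_map kappa xi Y.
  have /choice[c' c'E] j : exists t, f t = c j.
    apply: (@poly_subring_sub _ _ iota _ X [set b | exists t, f t = b]) (cT j).
    - by move=> b; exists b%:P%:P; rewrite /f /= coord_mapC inclk.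
    - move=> i; have [->|->] : i = ord0 \/ i = ord_max.
        by case: i => [[|[|//]] ?]; [left|right]; apply: val_inj.
        by exists t0; rewrite /f /= tx0 inclx.
      by exists t1; rewrite /f /= tx1 inclx.
    - by move=> u v [tu <-] [tv <-]; exists (tu + tv); rewrite rmorphD.
    - by move=> u v [tu <-] [tv <-]; exists (tu * tv); rewrite rmorphM.
  by exists c'; apply: eq_bigr => j _; rewrite -c'E.
pose linear_form xi := xi = x1 \/ exists c, xi = x0 - kappa c * x1.
have span_linear xi : linear_form xi -> exists Y, forall a,
    exists c : 'I_r -> {poly {poly k}},
      a = \sum_(j < r) incl (coord_map kappa xi Y (c j)) * s j.
  (* The complementary form [Y] is [x0] for [x1], and [x1] for [x0 - kappa c * x1]. *)
  case=> [->|[c ->]].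
    exists x0; apply: spanR; last by exists 'X; apply: coord_mapX.
    by exists 'X%:P; apply: coord_mapY.
  exists x1; apply: spanR; last by exists 'X%:P; apply: coord_mapY.
  exists ('X + c%:P%:P * 'X%:P).
  by rewrite rmorphD rmorphM coord_mapX coord_mapY coord_mapC subrK.
have span01 : forall a, exists c : 'I_r -> {poly {poly k}},
    a = \sum_(j < r) incl (coord_map kappa x0 x1 (c j)) * s j.
  by apply: spanR; [exists 'X; apply: coord_mapX|exists 'X%:P; apply: coord_mapY].
have intR := finite_integral_sub incl_inj span01.
have intA := finite_integral_over span01.
have dimR : has_krull_dim R 2 := krull_dim_integral intA incl_inj hdim.
(* [Z] is the zero ideal of [R], prime because [R] embeds in the domain [A]. *)
have [ZA ZAE] := zero_prime A; pose Z := comap incl ZA.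
have ZE z : (z \in Z) = (z == 0) by rewrite mem_comap ZAE -(inj_eq incl_inj) rmorph0.
have dimZ : has_krull_dim {ideal_quot Z} 2.
  apply/krull_dim_quot; have [[C sC] maxR] := dimR; split=> [|n [D [sD _]]].
    by exists C; split=> // z; rewrite ZE => /eqP ->; rewrite rpred0.
  by apply: maxR; exists D.
have dimP (P : prime_of_dim R 1) : has_krull_dim {ideal_quot (val P)} 1.
  exact/asboolP/(valP P).
have unique xi (P P' : prime_of_dim R 1) : linear_form xi -> xi != 0 ->
    xi \in val P -> xi \in val P' -> P = P'.
  move=> lxi xi0 xiP xiP'; have [Y spanY] := span_linear xi lxi.
  have gxi : grR m xi.
    case: lxi => [->|[c ->]]; first exact: gx.
    apply: (grading_B hR); first exact: gx.
    by rewrite -[m]add0n; apply: (grading_M hR) => //; apply: gx.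
  have Txi : poly_subring iota X (incl xi).
    case: lxi => [->|[c ->]]; first by rewrite inclx; apply: poly_subring_var.
    rewrite -mulNr -rmorphN rmorphD rmorphM inclk !inclx.
    apply: poly_subringD; first exact: poly_subring_var.
    by apply: poly_subringM; [apply: poly_subring_cst|apply: poly_subring_var].
  have xi0' : incl xi != 0 by rewrite -(rmorph0 incl) (inj_eq incl_inj).
  have gxi' : grA m (incl xi) by apply: hRA; exists xi.
  have /card_set_bijP[b [bfun binj _]] := hAss _ Txi gxi' xi0'.
  have inAss (Q : prime_ideal A) (P1 : prime_of_dim R 1) : comap incl Q = val P1 ->
      xi \in val P1 -> Ass 1 (quot_mod (multiples A^o (incl xi))) Q.
    move=> QP1 xiP1; split.
      have cX := coord_mapX kappa xi Y.
      rewrite -cX.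
      by apply: (coordinate_assoc incl_inj spanY _ (dimP P1) _ QP1); rewrite cX.
    apply: (@height1_over _ _ incl Q (incl xi)) => //; first by rewrite QP1; apply: dimP.
    by rewrite -mem_comap QP1.
  have [Q QP] := lying_over intA incl_inj (val P).
  have [Q' Q'P'] := lying_over intA incl_inj (val P').
  apply: val_inj; rewrite /= -QP -Q'P'; congr (comap _ _).
  have AQ := inAss Q P QP xiP; have AQ' := inAss Q' P' Q'P' xiP'.
  (* Both primes are sent to 0, the only element of [I_1]. *)
  apply: binj; rewrite ?inE //.
  by case: (b Q) (bfun Q AQ) => // _; case: (b Q') (bfun Q' AQ').
have finite_linear xi : linear_form xi -> xi != 0 ->
    finite_set [set P : prime_of_dim R 1 | xi \in val P].
  move=> lxi xi0.
  have [[P xiP]|nP] := pselect (exists P : prime_of_dim R 1, xi \in val P).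
    by apply: (sub_finite_set _ (finite_set1 P)) => P' /= xiP'; apply: (unique xi).
  by apply: (sub_finite_set _ (finite_set0 _)) => P' /= xiP'; apply: nP; exists P'.
have Z0 z : z \in Z -> z = 0 by rewrite ZE => /eqP.
have torsion_linear xi (P : prime_of_dim R 1) : linear_form xi -> xi != 0 ->
    xi \in val P -> torsion_cycle << P >>.
  move=> lxi xi0 xiP; have [Y spanY] := span_linear xi lxi.
  (* By [unique], no other prime of dimension 1 contains [xi]. *)
  apply: (torsion_cycle_div Z0 dimZ xi0 xiP (r := r)); last 1 first.
  - by move=> P' xiP' /eqP; rewrite (unique xi P' P).
  - have cX := coord_mapX kappa xi Y.
    rewrite -[X in local_dependence _ X]cX.
    by apply: (local_dependence_coordinate incl_inj spanY _ (dimP P)); rewrite cX.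
  - exact: finite_linear.
have linear_factors d h : grR d h -> h != 0 -> exists L : seq R,
    (forall xi, xi \in L -> xi != 0 /\ linear_form xi) /\
    forall P : prime_ideal R, h \in P -> exists2 xi, xi \in L & xi \in P.
  exact: (homogeneous_linear_factor m0 hR gkappa (gx _) (gx _) domR intR).
apply: chow_group_torsion => P.
have [[d [h [gh [h0 hP]]]]|noh] := pselect (exists d h, grR d h /\ h != 0 /\ h \in val P).
  have [L [Llin LP]] := linear_factors d h gh h0.
  have [xi /Llin[xi0 lxi] xiP] := LP _ hP.
  exact: (torsion_linear xi).
(* Otherwise [P] would be the zero ideal, whose quotient has dimension 2. *)
have [a aP a0] : exists2 a, a \in val P & a != 0.
  apply: contrapT => na; have PZ : val P = Z.
    apply: prime_ideal_inj => z; rewrite ZE; apply/idP/eqP => [zP|->]; last exact: rpred0.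
    by apply/eqP; apply: contrapT => /negP z0; apply: na; exists z.
  have [_ /(_ 2%N)] := dimP P; rewrite PZ => le21.
  by have := le21 dimZ.1.
have noh' d h : grR d h -> h \in val P -> h = 0.
  by move=> gh hP; apply/eqP; apply: contrapT => /negP h0; apply: noh; exists d, h.
have [f [l [d [fP f0 gl lP fdiv]]]] := homogeneously_principal hR noh' aP a0.
have l0 : l != 0 by apply: contraNneq lP => ->; apply: rpred0.
have [L [Llin LP]] := linear_factors d l gl l0.
(* If [l] were outside [P'], the relations [l ^+ n * g = f * z] would give [P] contained in [P'],
   hence equality in dimension 1. *)
have lP' (P' : prime_of_dim R 1) : f \in val P' -> P' != P -> l \in val P'.
  move=> fP' P'P; apply: contraNT P'P => lP'; apply/eqP/esym/val_inj/dim1_eq => //.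
  move=> g /fdiv[n [z zE]].
  have : l ^+ n * g \in val P' by rewrite zE mulrC idealMr.
  by rewrite prime_idealrM => /orP[/mem_primeX|//]; rewrite (negPf lP').
(* [r := 1], since [f] generates [P] locally at [P]. *)
apply: (torsion_cycle_div Z0 dimZ f0 fP (r := 1)); last 1 first.
- by move=> P' fP' /(lP' _ fP')/LP[xi /Llin[xi0 lxi] xiP']; apply: (torsion_linear xi).
(* Either [b ord0] is in [P], hence locally a multiple of [f], or it is a unit at [P] and
   [b ord_max] is locally a multiple of it. *)
- move=> b; have [b0P|b0P] := boolP (b ord0 \in val P).
    have [n [z zE]] := fdiv _ b0P; exists ord0, (l ^+ n), (fun=> 0), z.
    rewrite zE big_pred0 ?add0r //; split=> //.
    by apply: contra lP; apply: mem_primeX.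
  exists ord_max, (b ord0), (fun=> b ord_max), 0; split=> //.
  by rewrite (bigD1 ord0) //= big1 ?addr0 ?mulr0 1?mulrC ?addr0 // => -[[|[|//]] ?] //=.
(* Apart from [P], the primes containing [f] contain one of the finitely many linear factors in
   [L]. *)
- have finL : finite_set
      (\bigcup_(xi in [set` L]) [set P' : prime_of_dim R 1 | xi \in val P']).
    apply: bigcup_finite => [|xi /Llin[xi0 lxi]]; first exact: finite_seq.
    exact: finite_linear.
  apply: (sub_finite_set (B := P |` _)).
    2: by rewrite finite_setU; split; [exact: finite_set1|exact: finL].
  move=> P' /= fP'; have [->|P'P] := eqVneq P' P; first by left.
  by right; have [xi xiL xiP'] := LP _ (lP' _ fP' P'P); exists xi.
Qed.
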